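(* Over $\mathsf{RCA}_0$, $\mathsf{WKL}$ implies $\mathsf{RP}$. That is, $\mathsf{RCA}_0$ together with weak König's lemma proves that every topological dynamical system $(C,f)$ on $2^\omega$ contains a recurrent point.
   Context: Work in second order arithmetic; $\omega$ denotes the natural numbers of the model. $2^{<\omega}$ is the set of finite binary strings, $\lambda$ the empty string, $|\sigma|$ the length of $\sigma$, $\preceq$ the initial segment relation (also between a string and an infinite sequence), and $X\upharpoonright_n$ the initial segment of $X$ of length $n$. A tree is a subset of $2^{<\omega}$ closed under initial segments; $[C]$ denotes the collection of infinite paths through a tree $C$. A function $f:2^{<\omega}\to 2^{<\omega}$ encodes a continuous transformation of $2^\omega$ if (1) $f$ is total; (2) $f$ is order preserving, i.e. $\sigma\preceq\tau$ implies $f(\sigma)\preceq f(\tau)$; (3) $(\forall l)(\exists m)(\forall\sigma\in\{0,1\}^m)\,|f(\sigma)|\ge l$. By convention such an $f$ is also assumed to satisfy $|f(\sigma)|<|\sigma|$ for all $\sigma\ne\lambda$. The transformation encoded is $F(X)=\lim_l f(X\upharpoonright_l)$. Put $f^0(\sigma)=\sigma$, $f^k(\sigma)=f(f^{k-1}(\sigma))$ for $k>0$, and $F^k(X)=\lim_l f^k(X\upharpoonright_l)$. A pair $(C,f)$ is a (topological dynamical) system on $2^\omega$ if (i) $C$ is a tree; (ii) $f$ encodes a continuous transformation of $2^\omega$; (iii) $[C]\neq\emptyset$; (iv) for all $\sigma\in C$, $f(\sigma)\in C$. $X$ is a recurrent point of $(C,f)$ if $X\in[C]$ and $(\forall n,c)(\exists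 k)\,(F^{n+k}(X)\succeq X\upharpoonright_c)$. $\mathsf{RP}$ is the principle that every system on $2^\omega$ contains a recurrent point. $\mathsf{WKL}$ is the principle that every infinite subtree of $2^{<\omega}$ has an infinite path. *)

(* Defs.v *)
(** Subsystems of second order arithmetic are treated through their models:
    structures for the two-sorted language L2, in which the second sort need
    not contain every subset of the first, and the first need not be standard. *)

Record L2_structure : Type := {
  num : Type;
  sets : Type;
  zero : num;
  one : num;
  add : num -> num -> num;
  mul : num -> num -> num;
  lt : num -> num -> Prop;
  mem : num -> sets -> Prop;
  sets_inhabited : inhabited sets
}.

Arguments zero {_}.
Arguments one {_}.
Arguments add {_} _ _.
Arguments mul {_} _ _.
Arguments lt {_} _ _.
Arguments mem {_} _ _.

(** ** Bounded quantifier formulas *)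

(** De Bruijn indices, with separate index spaces for the two sorts.  Number
    quantifiers bind index 0; set variables only occur free, as parameters. *)

Inductive term : Type :=
| TVar (i : nat)
| TZero
| TOne
| TAdd (s t : term)
| TMul (s t : term).

(** The bound [t] of [FAllLt t p] and [FExLt t p] lies outside the scope of
    the variable bound in [p]. *)
Inductive bformula : Type :=
| FEq (s t : term)
| FLt (s t : term)
| FMem (t : term) (X : nat)
| FNot (p : bformula)
| FAnd (p q : bformula)
| FOr (p q : bformula)
| FImp (p q : bformula)
| FAllLt (t : term) (p : bformula)
| FExLt (t : term) (p : bformula).

Definition scons {A : Type} (x : A) (e : nat -> A) : nat -> A :=
  fun i => match i with O => x | S j => e j end.

Fixpoint eval {M : L2_structure} (e : nat -> num M) (t : term) : num M :=
  match t with
  | TVar i => e i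
  | TZero => zero
  | TOne => one
  | TAdd s t => add (eval e s) (eval e t)
  | TMul s t => mul (eval e s) (eval e t)
  end.

Fixpoint holds {M : L2_structure} (e : nat -> num M) (E : nat -> sets M)
    (p : bformula) : Prop :=
  match p with
  | FEq s t => eval e s = eval e t
  | FLt s t => lt (eval e s) (eval e t)
  | FMem t X => mem (eval e t) (E X)
  | FNot p => ~ holds e E p
  | FAnd p q => holds e E p /\ holds e E q
  | FOr p q => holds e E p \/ holds e E q
  | FImp p q => holds e E p -> holds e E q
  | FAllLt t p => forall x, lt x (eval e t) -> holds (scons x e) E p
  | FExLt t p => exists x, lt x (eval e t) /\ holds (scons x e) E p
  end.

(** For bounded [p], the predicates of [n] defined by the formulas
    "exists m, p" and "forall m, p"; in [p], index 0 is [m] and index 1 is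
    [n], the remaining variables being parameters from the model. *)
Definition Sigma01 {M : L2_structure} (p : bformula) (e : nat -> num M)
    (E : nat -> sets M) (n : num M) : Prop :=
  exists m, holds (scons m (scons n e)) E p.

Definition Pi01 {M : L2_structure} (p : bformula) (e : nat -> num M)
    (E : nat -> sets M) (n : num M) : Prop :=
  forall m, holds (scons m (scons n e)) E p.

Declare Scope L2_scope.
Delimit Scope L2_scope with L2.
Notation "0" := zero : L2_scope.
Notation "1" := one : L2_scope.
Notation "x + y" := (add x y) : L2_scope.
Notation "x * y" := (mul x y) : L2_scope.
Notation "x < y" := (lt x y) : L2_scope.
Notation "x <= y" := (lt x y \/ x = y) : L2_scope.
Notation "x 'is_in' X" := (mem x X) (at level 70) : L2_scope.
Local Open Scope L2_scope.

Record RCA0 (M : L2_structure) : Prop := {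
  succ_neq0 : forall n : num M, n + 1 <> 0;
  succ_inj : forall m n : num M, m + 1 = n + 1 -> m = n;
  add_0 : forall m : num M, m + 0 = m;
  add_succ : forall m n : num M, m + (n + 1) = (m + n) + 1;
  mul_0 : forall m : num M, m * 0 = 0;
  mul_succ : forall m n : num M, m * (n + 1) = m * n + m;
  not_lt0 : forall m : num M, ~ m < 0;
  lt_succ : forall m n : num M, m < n + 1 <-> m < n \/ m = n;
  Sigma01_induction :
    forall (p : bformula) (e : nat -> num M) (E : nat -> sets M),
      Sigma01 p e E 0 ->
      (forall n, Sigma01 p e E n -> Sigma01 p e E (n + 1)) ->
      forall n, Sigma01 p e E n;
  Delta01_comprehension :
    forall (p q : bformula) (e : nat -> num M) (E : nat -> sets M),
      (forall n, Sigma01 p e E n <-> Pi01 q e E n) ->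
      exists X : sets M, forall n, n is_in X <-> Sigma01 p e E n
}.

(** ** Coding of pairs, functions and binary strings *)

Definition pair {M : L2_structure} (i j : num M) : num M :=
  (i + j) * (i + j) + i.

Definition is_function {M : L2_structure} (D R : num M -> Prop) (f : sets M)
    : Prop :=
  (forall z, z is_in f -> exists x y, D x /\ R y /\ z = pair x y) /\
  (forall x, D x -> exists! y, pair x y is_in f).

Definition divides {M : L2_structure} (d n : num M) : Prop :=
  exists q, n = d * q.

(** A number [(k, (m, n))] presents the binary string of length [k] whose
    [i]-th entry is 1 exactly when [m * (i + 1) + 1] divides [n].  RCA0 proves
    that every string is presented in this way; its code is the least number
    presenting it, so that strings correspond bijectively to their codes. *)
Definition has_length {M : L2_structure} (s k : num M) : Prop :=
  exists m n, s = pair k (pair m n).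

Definition bit {M : L2_structure} (s i : num M) : Prop :=
  exists k m n, s = pair k (pair m n) /\ i < k /\ divides (m * (i + 1) + 1) n.

Definition is_string {M : L2_structure} (s : num M) : Prop :=
  exists k, has_length s k /\
    forall s', s' < s -> has_length s' k ->
      ~ (forall i, i < k -> (bit s' i <-> bit s i)).

Definition is_empty_string {M : L2_structure} (s : num M) : Prop :=
  is_string s /\ has_length s 0.

Definition prefix {M : L2_structure} (s t : num M) : Prop :=
  exists k l, has_length s k /\ has_length t l /\ k <= l /\
    forall i, i < k -> (bit s i <-> bit t i).

(** Elements of Cantor space are the sets of the model. *)
Definition prefix_of_set {M : L2_structure} (s : num M) (X : sets M) : Prop :=
  exists k, has_length s k /\ forall i, i < k -> (bit s i <-> i is_in X).

Definition restriction {M : L2_structure} (X : sets M) (n s : num M) : Prop :=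
  is_string s /\ has_length s n /\ prefix_of_set s X.

(** ** Trees *)

Definition is_tree {M : L2_structure} (T : sets M) : Prop :=
  (forall s, s is_in T -> is_string s) /\
  (forall s t, is_string s -> t is_in T -> prefix s t -> s is_in T).

Definition is_infinite {M : L2_structure} (X : sets M) : Prop :=
  forall k, exists n, n is_in X /\ k <= n.

Definition is_path {M : L2_structure} (T X : sets M) : Prop :=
  forall n, exists s, restriction X n s /\ s is_in T.

Definition WKL (M : L2_structure) : Prop :=
  forall T : sets M, is_tree T -> is_infinite T -> exists X, is_path T X.

(** ** Dynamical systems on Cantor space *)

Definition encodes_transformation {M : L2_structure} (f : sets M) : Prop :=
  is_function is_string is_string f /\
  (forall s t s' t', pair s s' is_in f -> pair t t' is_in f ->
     prefix s t -> prefix s' t') /\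
  (forall l, exists m, forall s s' k, has_length s m -> pair s s' is_in f ->
     has_length s' k -> l <= k) /\
  (forall s s' k l, pair s s' is_in f -> ~ is_empty_string s ->
     has_length s k -> has_length s' l -> l < k).

(** [t] is [f^k(s)].  If [f] is a function on strings then by primitive recursion
    in RCA0 there is a [g] as below for each string [s], with unique elements. *)
Definition iterate {M : L2_structure} (f : sets M) (k s t : num M) : Prop :=
  exists g : sets M,
    is_function (fun _ => True) is_string g /\
    pair 0 s is_in g /\
    (forall i r r', pair i r is_in g -> pair (i + 1) r' is_in g ->
       pair r r' is_in f) /\
    pair k t is_in g.

(** [Y] is the limit of the strings [f^k(s)], for [s] the restriction of [X]
    to [l], as [l] tends to infinity: every restriction of [Y] is eventually a
    prefix of them. *)
Definition iterated_image {M : L2_structure} (f : sets M) (k : num M)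
    (X Y : sets M) : Prop :=
  forall c, exists r, restriction Y c r /\
    exists l0, forall l, l0 <= l ->
      exists s t, restriction X l s /\ iterate f k s t /\ prefix r t.

Definition is_system {M : L2_structure} (C f : sets M) : Prop :=
  is_tree C /\
  encodes_transformation f /\
  (exists X, is_path C X) /\
  (forall s t, s is_in C -> pair s t is_in f -> t is_in C).

Definition recurrent_point {M : L2_structure} (C f X : sets M) : Prop :=
  is_path C X /\
  forall n c, exists k Y r,
    iterated_image f (n + k) X Y /\ restriction X c r /\ prefix_of_set r Y.

Definition RP (M : L2_structure) : Prop :=
  forall C f : sets M, is_system C f -> exists X, recurrent_point C f X.

(* Main.v *)
From Stdlib Require Import Classical ClassicalEpsilon FunctionalExtensionality PeanoNat Ring.
Require Import Defs.

Local Open Scope L2_scope.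

(** Call [k] a return time of [X] to a string [s] when [F^k(X)] extends [s].
    The recurrence of [X] follows from a condition with bounded search: for each
    string [s] that [X] extends there is a return time to [s] between [s] and
    [s + 3^s].  Indeed, given [n] and [c], take for [s] the restriction of [X] to
    [c + n]; the code of a string is at least its length, so the return time is
    at least [n].  The bound turns this condition on [X] into the condition
    that [X] is a path through a tree in the model, and weak Koenig's lemma
    gives such a path as soon as the tree is infinite.

    That it is infinite comes from an orbit [x_0, x_1, ...] of long strings in
    [C], where a simple combinatorial fact ([uniform_returns]) holds: for every
    [s], each interval of length [3^s] contains an index [i] such that [x_i] has
    a return time as above to every string with code below [s] that it
    extends.  One passes from [s] to [s + 1] with the interval growing by a factor of three.
    Take [i] from the first third for [s].  If [i] fails for the string [s], then
    no [x_j] with [j] in a whole interval of length [3^s] shortly after [i]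
    extends [s]; an index [j] for [s] in that interval then serves, vacuously,
    for [s + 1] as well.  No counting of strings is involved, and the
    induction is on a Pi01 predicate.

    The remaining work is to stay within the means of RCA0.  Finite
    sets are coded through least common multiples of pairwise coprime moduli
    ([bounded_set_code]), which also bounds the codes of the strings of a given
    length and so makes Sigma01 induction applicable to the moduli of continuity
    of the iterates of [f] ([orbit_length]).  Iteration is primitive recursion,
    by coded derivations ([derivation]).  Formulas are handled through
    classes of predicates on environments, [delta] and [sigma], with enough
    closure properties ([delta_of_sigma], [delta_subst]) for definability to be
    checked by a tactic. *)

Section Model.
Context {M : L2_structure}.

(** * Definable predicates *)

(** Environments are functions from variables to numbers.  Here numbers of the
    model count as constants, so that parameters may occur anywhere and are tied
    to variables only in [delta_formula]. *)
Inductive poly : ((nat -> num M) -> num M) -> Prop :=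
| poly_var i : poly (fun e => e i)
| poly_const a : poly (fun _ => a)
| poly_add s t : poly s -> poly t -> poly (fun e => s e + t e)
| poly_mul s t : poly s -> poly t -> poly (fun e => s e * t e).

(** The constructors are those of bounded formulas with set parameters.  Since
    every Delta01 set of the model may serve as such a parameter, this class
    is that of all Delta01 predicates: see [delta_of_sigma]. *)
Inductive delta : ((nat -> num M) -> Prop) -> Prop :=
| delta_poly_eq s t : poly s -> poly t -> delta (fun e => s e = t e)
| delta_poly_lt s t : poly s -> poly t -> delta (fun e => s e < t e)
| delta_poly_mem t X : poly t -> delta (fun e => t e is_in X)
| delta_not P : delta P -> delta (fun e => ~ P e)
| delta_and P Q : delta P -> delta Q -> delta (fun e => P e /\ Q e)
| delta_poly_ex t (P : num M -> (nat -> num M) -> Prop) :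
    poly t -> delta (fun e => P (e O) (fun i => e (S i))) ->
    delta (fun e => exists x, x < t e /\ P x e)
| delta_iff P Q : (forall e, P e <-> Q e) -> delta P -> delta Q.

Definition sigma (P : (nat -> num M) -> Prop) : Prop :=
  exists R : num M -> (nat -> num M) -> Prop,
    delta (fun e => R (e O) (fun i => e (S i))) /\
    forall e, P e <-> exists x, R x e.

Fixpoint rename_term (r : nat -> nat) (t : term) : term :=
  match t with
  | TVar i => TVar (r i)
  | TZero => TZero
  | TOne => TOne
  | TAdd s t => TAdd (rename_term r s) (rename_term r t)
  | TMul s t => TMul (rename_term r s) (rename_term r t)
  end.

Definition lift (r : nat -> nat) (i : nat) : nat :=
  match i with O => O | S j => S (r j) end.

Fixpoint rename (r R : nat -> nat) (p : bformula) : bformula :=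
  match p with
  | FEq s t => FEq (rename_term r s) (rename_term r t)
  | FLt s t => FLt (rename_term r s) (rename_term r t)
  | FMem t X => FMem (rename_term r t) (R X)
  | FNot p => FNot (rename r R p)
  | FAnd p q => FAnd (rename r R p) (rename r R q)
  | FOr p q => FOr (rename r R p) (rename r R q)
  | FImp p q => FImp (rename r R p) (rename r R q)
  | FAllLt t p => FAllLt (rename_term r t) (rename (lift r) R p)
  | FExLt t p => FExLt (rename_term r t) (rename (lift r) R p)
  end.

Lemma eval_rename r (e e' : nat -> num M) t :
  (forall i, e (r i) = e' i) -> eval e (rename_term r t) = eval e' t.
Proof. intro H; induction t; simpl; congruence. Qed.

Lemma holds_rename p : forall r R (e e' : nat -> num M) (E E' : nat -> sets M),
  (forall i, e (r i) = e' i) -> (forall i, E (R i) = E' i) ->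
  (holds e E (rename r R p) <-> holds e' E' p).
Proof.
  induction p; intros r R e e' E E' He HE; simpl;
    try rewrite !(eval_rename r e e') by exact He;
    try rewrite (IHp r R e e' E E' He HE);
    try rewrite (IHp1 r R e e' E E' He HE), (IHp2 r R e e' E E' He HE);
    try rewrite HE; try tauto.
  - assert (L : forall x, holds (scons x e) E (rename (lift r) R p) <->
                          holds (scons x e') E' p).
    { intro x; apply IHp; [intros [|i]; simpl; auto | exact HE]. }
    split; intros H x Hx; apply L; auto.
  - assert (L : forall x, holds (scons x e) E (rename (lift r) R p) <->
                          holds (scons x e') E' p).
    { intro x; apply IHp; [intros [|i]; simpl; auto | exact HE]. }
    split; intros (x & Hx & H); exists x; split; auto; apply L; auto.
Qed.

(** [rho] sends a variable of a formula either to a variable of the environment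
    or to a constant. *)
Definition inst (rho : nat -> nat + num M) (e : nat -> num M) (i : nat) : num M :=
  match rho i with inl j => e j | inr a => a end.

(** Two formulas are brought to common parameters by moving the variables of one
    to even indices and those of the other to odd indices. *)
Fixpoint interleave {A : Type} (f g : nat -> A) (i : nat) : A :=
  match i with
  | O => f O
  | S O => g O
  | S (S i) => interleave (fun j => f (S j)) (fun j => g (S j)) i
  end.

Definition evens (i : nat) : nat := Nat.add i i.
Definition odds (i : nat) : nat := S (Nat.add i i).

Lemma interleave_evens {A} i : forall f g : nat -> A, interleave f g (evens i) = f i.
Proof.
  unfold evens; induction i; intros f g; simpl; auto.
  rewrite <- plus_n_Sm; apply (IHi (fun j => f (S j))).
Qed.

Lemma interleave_odds {A} i : forall f g : nat -> A, interleave f g (odds i) = g i.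
Proof.
  unfold odds; induction i; intros f g; auto.
  change (S (Nat.add (S i) (S i))) with (S (S (Nat.add i (S i)))).
  rewrite <- plus_n_Sm; apply (IHi (fun j => f (S j)) (fun j => g (S j))).
Qed.

Lemma inst_interleave_evens rho rho' e i :
  inst (interleave rho rho') e (evens i) = inst rho e i.
Proof. unfold inst; now rewrite interleave_evens. Qed.

Lemma inst_interleave_odds rho rho' e i :
  inst (interleave rho rho') e (odds i) = inst rho' e i.
Proof. unfold inst; now rewrite interleave_odds. Qed.

Lemma poly_term t : poly t -> exists u rho, forall e, eval (inst rho e) u = t e.
Proof.
  induction 1 as [i|a|s t _ (u & rho & IHs) _ (v & rho' & IHt)
                     |s t _ (u & rho & IHs) _ (v & rho' & IHt)].
  - now exists (TVar i), (fun i => inl i).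
  - now exists (TVar O), (fun _ => inr a).
  - exists (TAdd (rename_term evens u) (rename_term odds v)), (interleave rho rho').
    intro e; simpl; rewrite <- IHs, <- IHt; f_equal; apply eval_rename; intro;
      auto using inst_interleave_evens, inst_interleave_odds.
  - exists (TMul (rename_term evens u) (rename_term odds v)), (interleave rho rho').
    intro e; simpl; rewrite <- IHs, <- IHt; f_equal; apply eval_rename; intro;
      auto using inst_interleave_evens, inst_interleave_odds.
Qed.

Lemma delta_formula P : delta P ->
  exists p rho E, forall e, holds (inst rho e) E p <-> P e.
Proof.
  destruct (sets_inhabited M) as [X0].
  induction 1 as [s t Hs Ht|s t Hs Ht|t X Ht|P _ (p & rho & E & IH)
                 |P Q _ (p & rho & E & IHP) _ (q & rho' & E' & IHQ)
                 |t P Ht _ (q & rho' & E & IH)|P Q HPQ _ (p & rho & E & IH)].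
  - destruct (poly_term s Hs) as (u & rho & Hu), (poly_term t Ht) as (v & rho' & Hv).
    exists (FEq (rename_term evens u) (rename_term odds v)), (interleave rho rho'),
      (fun _ => X0); intro e; simpl.
    rewrite (eval_rename _ _ _ _ (inst_interleave_evens rho rho' e)).
    rewrite (eval_rename _ _ _ _ (inst_interleave_odds rho rho' e)).
    rewrite Hu, Hv; tauto.
  - destruct (poly_term s Hs) as (u & rho & Hu), (poly_term t Ht) as (v & rho' & Hv).
    exists (FLt (rename_term evens u) (rename_term odds v)), (interleave rho rho'),
      (fun _ => X0); intro e; simpl.
    rewrite (eval_rename _ _ _ _ (inst_interleave_evens rho rho' e)).
    rewrite (eval_rename _ _ _ _ (inst_interleave_odds rho rho' e)).
    rewrite Hu, Hv; tauto.
  - destruct (poly_term t Ht) as (u & rho & Hu).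
    exists (FMem u O), rho, (fun _ => X); intro e; simpl; rewrite Hu; tauto.
  - exists (FNot p), rho, E; intro e; simpl; rewrite IH; tauto.
  - exists (FAnd (rename evens evens p) (rename odds odds q)),
      (interleave rho rho'), (interleave E E'); intro e; simpl.
    rewrite (holds_rename p _ _ _ _ _ _ (inst_interleave_evens rho rho' e)
               (fun i => interleave_evens i E E')).
    rewrite (holds_rename q _ _ _ _ _ _ (inst_interleave_odds rho rho' e)
               (fun i => interleave_odds i E E')).
    rewrite IHP, IHQ; tauto.
  - destruct (poly_term t Ht) as (u & rho & Hu).
    (* The bound variable keeps index 0; all others move under the binder. *)
    pose (r := fun i => match rho' i with inl O => O | _ => S (odds i) end).
    pose (rho'' := fun i => match rho' i with
                            | inl O => inr zero | inl (S j) => inl j | inr a => inr a end).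
    exists (FExLt (rename_term evens u) (rename r (fun i => i) q)),
      (interleave rho rho''), E; intro e; simpl.
    rewrite (eval_rename _ _ _ _ (inst_interleave_evens rho rho'' e)), Hu.
    assert (L : forall x, holds (scons x (inst (interleave rho rho'') e)) E
                            (rename r (fun i => i) q) <-> P x e).
    { intro x; rewrite (holds_rename q r (fun i => i) _ (inst rho' (scons x e)) E E).
      - apply IH.
      - intro i; unfold r, inst; destruct (rho' i) as [[|j]|a] eqn:D; cbn [scons]; trivial;
          rewrite interleave_odds; unfold rho''; now rewrite D.
      - reflexivity. }
    split; intros (x & Hx & H); exists x; split; auto; apply L; auto.
  - exists p, rho, E; intro e; rewrite IH; apply HPQ.
Qed.

(** ** Closure properties *)

(** By excluded middle, a statement about parameters alone amounts to a true or a
    false formula. *)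
Lemma delta_const (A : Prop) : delta (fun _ => A).
Proof.
  destruct (classic A) as [H|H].
  - apply (delta_iff (fun _ => zero = zero :> num M)); [tauto|].
    apply delta_poly_eq; apply poly_const.
  - apply (delta_iff (fun _ => ~ zero = zero :> num M)); [tauto|].
    apply delta_not, delta_poly_eq; apply poly_const.
Qed.

Lemma delta_or P Q : delta P -> delta Q -> delta (fun e => P e \/ Q e).
Proof.
  intros HP HQ; apply (delta_iff (fun e => ~ (~ P e /\ ~ Q e))).
  - intro e; destruct (classic (P e)), (classic (Q e)); tauto.
  - now apply delta_not, delta_and; apply delta_not.
Qed.

Lemma delta_imp P Q : delta P -> delta Q -> delta (fun e => P e -> Q e).
Proof.
  intros HP HQ; apply (delta_iff (fun e => ~ (P e /\ ~ Q e))).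
  - intro e; destruct (classic (P e)), (classic (Q e)); tauto.
  - now apply delta_not, delta_and; [|apply delta_not].
Qed.

Lemma delta_equiv P Q : delta P -> delta Q -> delta (fun e => P e <-> Q e).
Proof. intros; apply delta_and; apply delta_imp; assumption. Qed.

Lemma delta_poly_all t (P : num M -> (nat -> num M) -> Prop) :
  poly t -> delta (fun e => P (e O) (fun i => e (S i))) ->
  delta (fun e => forall x, x < t e -> P x e).
Proof.
  intros Ht HP; apply (delta_iff (fun e => ~ exists x, x < t e /\ ~ P x e)).
  - intro e; split.
    + intros H x Hx; apply NNPP; intro; apply H; now exists x.
    + intros H (x & Hx & N); auto.
  - apply delta_not.
    apply (delta_poly_ex t (fun x e => ~ P x e)); [exact Ht | now apply delta_not].
Qed.

Lemma poly_subst (r : nat -> (nat -> num M) -> num M) t :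
  (forall i, poly (r i)) -> poly t -> poly (fun e => t (fun i => r i e)).
Proof.
  intros Hr; induction 1; auto using poly.
Qed.

Lemma delta_poly_subst P : delta P -> forall r : nat -> (nat -> num M) -> num M,
  (forall i, poly (r i)) -> delta (fun e => P (fun i => r i e)).
Proof.
  induction 1 as [s t Hs Ht|s t Hs Ht|t X Ht|P _ IH|P Q _ IHP _ IHQ
                 |t P Ht _ IH|P Q HPQ _ IH]; intros r Hr.
  - apply (delta_poly_eq (fun e => s (fun i => r i e)) (fun e => t (fun i => r i e)));
      now apply poly_subst.
  - apply (delta_poly_lt (fun e => s (fun i => r i e)) (fun e => t (fun i => r i e)));
      now apply poly_subst.
  - apply (delta_poly_mem (fun e => t (fun i => r i e))); now apply poly_subst.
  - apply (delta_not (fun e => P (fun i => r i e))); auto.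
  - apply (delta_and (fun e => P (fun i => r i e)) (fun e => Q (fun i => r i e))); auto.
  - apply (delta_poly_ex (fun e => t (fun i => r i e)) (fun x e => P x (fun i => r i e))).
    + now apply poly_subst.
    + apply (IH (fun i => match i with
                          | O => fun e => e O | S j => fun e => r j (fun i => e (S i)) end)).
      intros [|j]; [apply poly_var|].
      apply (poly_subst (fun i e => e (S i))); auto using poly.
  - apply (delta_iff (fun e => P (fun i => r i e))); auto.
Qed.

Lemma delta_rename P (r : nat -> nat) : delta P -> delta (fun e => P (fun i => e (r i))).
Proof. intro H; apply (delta_poly_subst P H (fun i e => e (r i))); auto using poly. Qed.

(** A formula has finitely many variables; [delta_of_sigma] can therefore
    pack them into a single number. *)
Lemma delta_finite_support P : delta P ->
  exists n, forall e e', (forall i, Nat.lt i n -> e i = e' i) -> P e -> P e'.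
Proof.
  assert (Hpoly : forall t, poly t -> exists n, forall e e',
    (forall i, Nat.lt i n -> e i = e' i) -> t e = t e').
  { induction 1 as [i|a|s t _ (n & Hn) _ (m & Hm)|s t _ (n & Hn) _ (m & Hm)].
    - exists (S i); intros e e' H; apply H; constructor.
    - now exists O.
    - exists (Nat.max n m); intros e e' H.
      rewrite (Hn e e'), (Hm e e'); trivial; intros i Hi; apply H;
        eauto using Nat.lt_le_trans, Nat.le_max_l, Nat.le_max_r.
    - exists (Nat.max n m); intros e e' H.
      rewrite (Hn e e'), (Hm e e'); trivial; intros i Hi; apply H;
        eauto using Nat.lt_le_trans, Nat.le_max_l, Nat.le_max_r. }
  assert (Hmax : forall n m e e', (forall i, Nat.lt i (Nat.max n m) -> e i = e' i) ->
     (forall i, Nat.lt i n -> e i = e' i :> num M) /\ (forall i, Nat.lt i m -> e i = e' i)).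
  { intros n m e e' H; split; intros i Hi; apply H;
      eauto using Nat.lt_le_trans, Nat.le_max_l, Nat.le_max_r. }
  induction 1 as [s t Hs Ht|s t Hs Ht|t X Ht|P _ (n & IH)|P Q _ (n & IHP) _ (m & IHQ)
                 |t P Ht _ (m & IH)|P Q HPQ _ (n & IH)].
  - destruct (Hpoly s Hs) as (n & Hn), (Hpoly t Ht) as (m & Hm).
    exists (Nat.max n m); intros e e' H; apply Hmax in H as [H1 H2].
    rewrite (Hn e e' H1), (Hm e e' H2); trivial.
  - destruct (Hpoly s Hs) as (n & Hn), (Hpoly t Ht) as (m & Hm).
    exists (Nat.max n m); intros e e' H; apply Hmax in H as [H1 H2].
    rewrite (Hn e e' H1), (Hm e e' H2); trivial.
  - destruct (Hpoly t Ht) as (n & Hn).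
    exists n; intros e e' H; rewrite (Hn e e' H); trivial.
  - exists n; intros e e' H N P'; apply N, (IH e' e); auto using eq_sym.
  - exists (Nat.max n m); intros e e' H [HP HQ]; apply Hmax in H as [H1 H2]; eauto.
  - destruct (Hpoly t Ht) as (n & Hn).
    exists (Nat.max n m); intros e e' H (x & Hx & HP); apply Hmax in H as [H1 H2].
    exists x; split; [now rewrite <- (Hn e e' H1)|].
    apply (IH (scons x e) (scons x e')); trivial.
    intros [|i] Hi; simpl; trivial; apply H2, Nat.lt_succ_l, Hi.
  - exists n; intros e e' H HQ; apply HPQ; apply (IH e e' H); apply HPQ, HQ.
Qed.

(** * Arithmetic in a model of RCA0 *)

Context (HM : RCA0 M).

(** The axioms of RCA0 mention one list of parameters; comprehension needs it
    to serve two formulas at once. *)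
Lemma delta_formula_pair (R R' : num M -> (nat -> num M) -> Prop) :
  delta (fun e => R (e O) (fun i => e (S i))) ->
  delta (fun e => R' (e O) (fun i => e (S i))) ->
  exists p p' e0 E, forall m n,
    (holds (scons m (scons n e0)) E p <-> R m (scons n (fun _ => 0))) /\
    (holds (scons m (scons n e0)) E p' <-> R' m (scons n (fun _ => 0))).
Proof.
  intros HR HR'.
  destruct (delta_formula _ HR) as (p & rho & E & Hp).
  destruct (delta_formula _ HR') as (p' & rho' & E' & Hp').
  pose (idx := fun (rho : nat -> nat + num M) (half : nat -> nat) i =>
    match rho i with inl O => O | inl (S O) => S O | _ => S (S (half i)) end).
  pose (val := fun (rho : nat -> nat + num M) i =>
    match rho i with inl _ => 0 | inr a => a end).
  exists (rename (idx rho evens) evens p), (rename (idx rho' odds) odds p'),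
    (interleave (val rho) (val rho')), (interleave E E').
  intros m n; split.
  - rewrite (holds_rename p _ _ _ (inst rho (scons m (scons n (fun _ => 0)))) _ E);
      [apply Hp | | intro; apply interleave_evens].
    intro i; unfold idx, inst; destruct (rho i) as [[|[|j]]|a] eqn:D; cbn [scons];
      trivial; rewrite interleave_evens; unfold val; now rewrite D.
  - rewrite (holds_rename p' _ _ _ (inst rho' (scons m (scons n (fun _ => 0)))) _ E');
      [apply Hp' | | intro; apply interleave_odds].
    intro i; unfold idx, inst; destruct (rho' i) as [[|[|j]]|a] eqn:D; cbn [scons];
      trivial; rewrite interleave_odds; unfold val; now rewrite D.
Qed.

Lemma sigma_induction (P : num M -> Prop) : sigma (fun e => P (e O)) ->
  P 0 -> (forall n, P n -> P (n + 1)) -> forall n, P n.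
Proof.
  intros (R & HR & HP) H0 HS.
  destruct (delta_formula_pair R R HR HR) as (p & q & e & E & Hp).
  assert (L : forall n, Sigma01 p e E n <-> P n).
  { intro n; rewrite (HP (scons n (fun _ => 0))).
    split; intros [m H]; exists m; now apply (proj1 (Hp m n)). }
  intro n; apply L; apply (Sigma01_induction M HM); [now apply L|].
  intros k Hk; apply L, HS, L, Hk.
Qed.

Lemma sigma_comprehension (P : num M -> Prop) :
  sigma (fun e => P (e O)) -> sigma (fun e => ~ P (e O)) ->
  exists X : sets M, forall n, n is_in X <-> P n.
Proof.
  intros (R & HR & HP) (R' & HR' & HP').
  destruct (delta_formula_pair R (fun x e => ~ R' x e) HR (delta_not _ HR'))
    as (p & q & e & E & H).
  assert (Lp : forall n, Sigma01 p e E n <-> P n).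
  { intro n; rewrite (HP (scons n (fun _ => 0))).
    split; intros [m Hm]; exists m; now apply (H m n). }
  destruct (Delta01_comprehension M HM p q e E) as [X HX].
  - intro n; rewrite Lp; split.
    + intros Hn m; apply (H m n); intro N; apply (HP' (scons n (fun _ => 0))); eauto.
    + intros Hq; apply NNPP; intro N.
      apply (HP' (scons n (fun _ => 0))) in N as [m Hm]; now apply (H m n) in Hm.
  - exists X; intro n; rewrite HX; apply Lp.
Qed.

Lemma delta_sigma P : delta P -> sigma P.
Proof.
  intro HP; exists (fun _ e => P e); split.
  - apply (delta_rename P S HP).
  - intro e; split; [intro H; now exists 0 | now intros [_ H]].
Qed.

Lemma delta_induction (P : num M -> Prop) : delta (fun e => P (e O)) ->
  P 0 -> (forall n, P n -> P (n + 1)) -> forall n, P n.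
Proof. intro H; apply sigma_induction; now apply delta_sigma. Qed.

Ltac polynomial :=
  cbn beta iota; first
  [ eassumption
  | apply poly_const | apply poly_var
  | apply poly_add; polynomial
  | apply poly_mul; polynomial ].

Ltac definable0 :=
  cbn beta iota; first
  [ eassumption
  | apply delta_const
  | apply delta_poly_eq; polynomial
  | apply delta_poly_lt; polynomial
  | apply delta_poly_mem; polynomial
  | apply delta_not; definable0
  | apply delta_and; definable0
  | apply delta_or; definable0
  | apply delta_poly_ex; [polynomial | definable0]
  | apply delta_poly_all; [polynomial | definable0]
  | apply delta_imp; definable0 ].

(** Here [t] establishes that the statement, as a predicate of [n], is [delta]. *)
Tactic Notation "induct" ident(n) "by" tactic3(t) :=
  revert n; refine (delta_induction _ _ _ _); [t | | intros n ?IH].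

Lemma add_0_l (a : num M) : 0 + a = a.
Proof. induct a by definable0; [apply (add_0 M HM)|]. now rewrite (add_succ M HM), IH. Qed.

Lemma add_1_l (a b : num M) : (a + 1) + b = a + b + 1.
Proof.
  induct b by definable0; rewrite ?(add_0 M HM), ?(add_succ M HM), ?IH; trivial.
Qed.

Lemma add_comm (a b : num M) : a + b = b + a.
Proof.
  induct b by definable0; rewrite ?(add_0 M HM), ?add_0_l, ?(add_succ M HM), ?add_1_l, ?IH;
    trivial.
Qed.

Lemma add_assoc (a b c : num M) : a + (b + c) = a + b + c.
Proof.
  induct c by definable0; rewrite ?(add_0 M HM), ?(add_succ M HM), ?IH; trivial.
Qed.

Lemma mul_0_l (a : num M) : 0 * a = 0.
Proof.
  induct a by definable0; rewrite ?(mul_0 M HM), ?(mul_succ M HM), ?IH, ?(add_0 M HM);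
    trivial.
Qed.

Lemma mul_succ_l (a b : num M) : (a + 1) * b = a * b + b.
Proof.
  induct b by definable0; rewrite ?(mul_0 M HM), ?(mul_succ M HM), ?IH, ?(add_0 M HM);
    trivial.
  rewrite <- !add_assoc; f_equal; now rewrite !add_assoc, (add_comm b a).
Qed.

Lemma mul_comm (a b : num M) : a * b = b * a.
Proof.
  induct b by definable0; rewrite ?(mul_0 M HM), ?mul_0_l, ?(mul_succ M HM), ?mul_succ_l, ?IH;
    trivial.
Qed.

Lemma mul_add_l (a b c : num M) : (a + b) * c = a * c + b * c.
Proof.
  induct c by definable0; rewrite ?(mul_0 M HM), ?(mul_succ M HM), ?IH, ?(add_0 M HM);
    trivial.
  rewrite <- !add_assoc; f_equal; now rewrite !add_assoc, (add_comm a (b * c)).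
Qed.

Lemma mul_assoc (a b c : num M) : a * (b * c) = a * b * c.
Proof.
  induct c by definable0; rewrite ?(mul_0 M HM), ?(mul_succ M HM); trivial.
  rewrite (mul_comm a), mul_add_l, <- IH; now rewrite !(mul_comm _ a).
Qed.

Lemma mul_1_l (a : num M) : 1 * a = a.
Proof. now rewrite <- (add_0_l 1), mul_succ_l, mul_0_l, add_0_l. Qed.

Lemma num_semi_ring : semi_ring_theory zero one add mul (@eq (num M)).
Proof.
  constructor; auto using add_0_l, add_comm, add_assoc, mul_1_l, mul_0_l, mul_comm,
    mul_assoc, mul_add_l.
Qed.

Add Ring num_ring : num_semi_ring.

Lemma add_cancel (a b c : num M) : a + c = b + c -> a = b.
Proof.
  induct c by definable0; intro H; [now rewrite !(add_0 M HM) in H|].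
  apply IH, (succ_inj M HM); now rewrite <- !add_assoc.
Qed.

Lemma add_cancel_l (a b c : num M) : c + a = c + b -> a = b.
Proof. rewrite !(add_comm c); apply add_cancel. Qed.

(** The bound that would make this a bounded statement is part of what is being
    proved, hence Sigma01 induction. *)
Lemma lt_exists (a b : num M) : a < b -> exists c, b = a + c + 1.
Proof.
  revert b; refine (sigma_induction _ _ _ _).
  - exists (fun c e => a < e O -> e O = a + c + 1); split; [definable0|].
    intro e; split; [|intros [c Hc]; eauto].
    destruct (classic (a < e O)) as [H|H]; intro Hc; [destruct (Hc H)|exists 0]; eauto.
    now intro.
  - intro H; now apply (not_lt0 M HM) in H.
  - intros b IH H; apply (lt_succ M HM) in H as [H|<-].
    + destruct (IH H) as (c & ->); exists (c + 1); ring.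
    + exists 0; ring.
Qed.

Lemma lt_add (a c : num M) : a < a + c + 1.
Proof.
  induct c by definable0; apply (lt_succ M HM); [right; ring|left].
  now replace (a + (c + 1)) with (a + c + 1) by ring.
Qed.

Lemma le_exists (a b : num M) : a <= b -> exists c, b = a + c.
Proof.
  intros [H| ->]; [apply lt_exists in H as [c ->]; exists (c + 1) | exists 0]; ring.
Qed.

Lemma zero_or_succ (a : num M) : a = 0 \/ exists b, a = b + 1.
Proof.
  destruct (classic (a = 0)) as [|N]; [now left|right].
  enough (a = 0 \/ 0 < a) as [|H] by
    (contradiction || (apply lt_exists in H as [c ->]; exists c; ring)).
  clear N; induct a by definable0; [now left|right; apply (lt_succ M HM)].
  destruct IH as [->|]; auto.
Qed.

Lemma le_add (a c : num M) : a <= a + c.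
Proof.
  destruct (zero_or_succ c) as [->|[d ->]]; [right; ring|left].
  rewrite add_assoc; apply lt_add.
Qed.

Lemma le_intro (a b c : num M) : b = a + c -> a <= b.
Proof. intros ->; apply le_add. Qed.

Lemma lt_intro (a b c : num M) : b = a + c + 1 -> a < b.
Proof. intros ->; apply lt_add. Qed.

Lemma lt_le_succ (a b : num M) : a < b <-> a + 1 <= b.
Proof.
  split; intro H.
  - apply lt_exists in H as [c ->]; apply (le_intro _ _ c); ring.
  - apply le_exists in H as [c ->]; apply (lt_intro _ _ c); ring.
Qed.

Lemma le_sum (a b c d : num M) : a <= b -> c <= d -> a + c <= b + d.
Proof.
  intros H K; apply le_exists in H as [x ->]; apply le_exists in K as [y ->].
  apply (le_intro _ _ (x + y)); ring.
Qed.

Lemma le_linear (a b c d e : num M) : a <= b -> d + a = c + b + e -> c <= d.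
Proof.
  intros H E; apply le_exists in H as [x ->]; apply (le_intro _ _ (x + e)).
  apply (add_cancel _ _ a); rewrite E; ring.
Qed.

Lemma no_lt_self (a b c : num M) : a <= b -> a = b + c + 1 -> False.
Proof.
  intros H ->; apply le_exists in H as [x E].
  apply (succ_neq0 M HM (c + x)), (add_cancel _ _ b).
  rewrite E at 2; ring.
Qed.

Lemma le_or_lt (a b : num M) : a <= b \/ b < a.
Proof.
  induct a by definable0.
  - left; apply (le_intro _ _ b); ring.
  - destruct IH as [[H| ->]|H].
    + left; now apply lt_le_succ.
    + right; apply (lt_intro _ _ 0); ring.
    + right; apply lt_exists in H as [c ->]; apply (lt_intro _ _ (c + 1)); ring.
Qed.

Lemma le_zero (a : num M) : 0 <= a.
Proof. apply (le_intro _ _ a); ring. Qed.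

Lemma eq_le (a b : num M) : a = b -> a <= b.
Proof. now right. Qed.

Ltac as_le H :=
  lazymatch H with
  | (?A, ?B) =>
    let a := as_le A in let b := as_le B in constr:(le_sum _ _ _ _ a b)
  | _ =>
    lazymatch type of H with
    | _ < _ => constr:(proj1 (lt_le_succ _ _) H)
    | _ <= _ => H
    | _ = _ => constr:(eq_le _ _ H)
    end
  end.

(** [linear (H1, ..., Hn)] proves an inequality that differs from the sum of
    the inequalities [H1], ..., [Hn] by a slack of at most 3. *)
Ltac linear H :=
  let h := as_le H in
  let slack tac :=
    first [tac (zero : num M) | tac (one : num M) | tac (one + one : num M)
          | tac (one + one + one : num M) | fail 1 "not a linear consequence"] in
  lazymatch goal with
  | |- False => slack ltac:(fun e => apply (no_lt_self _ _ e h); ring)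
  | |- _ < _ => apply lt_le_succ; slack ltac:(fun e => apply (le_linear _ _ _ _ e h); ring)
  | |- _ <= _ => slack ltac:(fun e => apply (le_linear _ _ _ _ e h); ring)
  end.

Lemma le_refl (a : num M) : a <= a.
Proof. now right. Qed.

Lemma le_trans (a b c : num M) : a <= b -> b <= c -> a <= c.
Proof. intros H K; linear (H, K). Qed.

Lemma lt_le_trans (a b c : num M) : a < b -> b <= c -> a < c.
Proof. intros H K; linear (H, K). Qed.

Lemma lt_le (a b : num M) : a < b -> a <= b.
Proof. now left. Qed.

Lemma lt_irrefl (a : num M) : ~ a < a.
Proof. intro H; linear H. Qed.

Lemma lt_succ_le (a b : num M) : a < b + 1 <-> a <= b.
Proof. apply (lt_succ M HM). Qed.

Lemma not_lt (a b : num M) : ~ a < b <-> b <= a.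
Proof.
  split; [destruct (le_or_lt b a); tauto|].
  intros H K; linear (H, K).
Qed.

Lemma lt_trichotomy (a b : num M) : a < b \/ a = b \/ b < a.
Proof. destruct (le_or_lt a b) as [[|]|]; auto. Qed.

Lemma mul_le (a b c d : num M) : a <= b -> c <= d -> a * c <= b * d.
Proof.
  intros H K; apply le_exists in H as [x ->]; apply le_exists in K as [y ->].
  apply (le_intro _ _ (a * y + x * c + x * y)); ring.
Qed.

Lemma sigma_iff P Q : (forall e, P e <-> Q e) -> sigma P -> sigma Q.
Proof.
  intros H (R & HR & HP); exists R; split; trivial.
  intro e; now rewrite <- H.
Qed.

(** Two unbounded witnesses are contracted to a common strict bound for both. *)
Lemma sigma_and P Q : sigma P -> sigma Q -> sigma (fun e => P e /\ Q e).
Proof.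
  intros (R & HR & HP) (S' & HS & HQ).
  exists (fun z e => exists x, x < z /\ R x e /\ exists y, y < z /\ S' y e); split.
  - assert (HR' := delta_rename _ (fun i => match i with O => O | S i => S (S i) end) HR).
    assert (HS' := delta_rename _ (fun i => match i with O => O | S i => S (S (S i)) end) HS).
    definable0.
  - intro e; rewrite HP, HQ; split.
    + intros [[x Hx] [y Hy]]; exists (x + y + 1), x; split; [linear (le_zero y)|].
      split; trivial; exists y; split; trivial; linear (le_zero x).
    + intros (z & x & _ & Hx & y & _ & Hy); eauto.
Qed.

Lemma sigma_or P Q : sigma P -> sigma Q -> sigma (fun e => P e \/ Q e).
Proof.
  intros (R & HR & HP) (S' & HS & HQ).
  exists (fun x e => R x e \/ S' x e); split; [definable0|].
  intro e; rewrite HP, HQ; split;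
    [intros [[x H]|[x H]] | intros [x [H|H]]]; eauto.
Qed.

Lemma sigma_ex (P : num M -> (nat -> num M) -> Prop) :
  sigma (fun e => P (e O) (fun i => e (S i))) -> sigma (fun e => exists x, P x e).
Proof.
  intros (R & HR & HP).
  exists (fun z e => exists x, x < z /\ exists y, y < z /\ R y (scons x e)); split.
  - assert (HR' := delta_rename _
      (fun i => match i with O => O | S O => S O | S i => S (S i) end) HR).
    apply delta_poly_ex; [polynomial|apply delta_poly_ex; [polynomial|]].
    refine (delta_iff _ _ _ HR'); intro e; cbn beta iota.
    replace (scons (e (S O)) (fun i => e (S (S (S i)))))
      with (fun i => e match i with O => S O | S _ => S (S i) end); [tauto|].
    apply functional_extensionality; now intros [|i].
  - intro e; split.
    + intros [x Hx]; apply (HP (scons x e)) in Hx as [y Hy].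
      exists (x + y + 1), x; split; [linear (le_zero y)|].
      exists y; split; trivial; linear (le_zero x).
    + intros (z & x & _ & y & _ & H); exists x; apply (HP (scons x e)); eauto.
Qed.

(** * Delta01 predicates and recursive functions *)

Lemma pair_lt (a b c d : num M) : a + b < c + d -> pair a b < pair c d.
Proof.
  intro H; apply lt_exists in H as [x E]; unfold pair; rewrite E.
  apply (lt_intro _ _ ((a + b) * x + (a + b) * x + a + b + b + x * x + x + x + c)); ring.
Qed.

Lemma pair_inj (a b c d : num M) : pair a b = pair c d -> a = c /\ b = d.
Proof.
  intro E; destruct (lt_trichotomy (a + b) (c + d)) as [H|[H|H]].
  - apply pair_lt in H; rewrite E in H; now apply lt_irrefl in H.
  - unfold pair in E; rewrite H in E.
    apply add_cancel_l in E as ->; split; trivial; now apply add_cancel_l in H.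
  - apply pair_lt in H; rewrite E in H; now apply lt_irrefl in H.
Qed.

Lemma le_pair_l (a b : num M) : a <= pair a b.
Proof. apply (le_intro _ _ ((a + b) * (a + b))); unfold pair; ring. Qed.

Lemma le_pair_r (a b : num M) : b <= pair a b.
Proof.
  destruct (zero_or_succ b) as [->|[y ->]]; [apply le_zero|].
  apply (le_intro _ _ ((a + y) * (a + y) + a + a + y + a)); unfold pair; ring.
Qed.

Lemma pair_le (a b c d : num M) : a <= c -> b <= d -> pair a b <= pair c d.
Proof. intros; unfold pair; auto using le_sum, mul_le. Qed.

Lemma sigma_rename P (r : nat -> nat) : sigma P -> sigma (fun e => P (fun i => e (r i))).
Proof.
  intros (R & HR & HP); exists (fun x e => R x (fun i => e (r i))); split; [|auto].
  exact (delta_rename _ (fun i => match i with O => O | S j => S (r j) end) HR).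
Qed.

(** For a single variable this is comprehension: the predicate becomes membership
    in a set.  Several variables are packed into one by pairing, two at a time,
    and pairs are polynomials, which may be substituted back. *)
Lemma delta_of_sigma_support n : forall P,
  (forall e e', (forall i, Nat.lt i (S n) -> e i = e' i) -> P e -> P e') ->
  sigma P -> sigma (fun e => ~ P e) -> delta P.
Proof.
  induction n as [|n IH]; intros P Hsup HP HN.
  - destruct (sigma_comprehension (fun x => P (fun _ => x))) as [X HX].
    + exact (sigma_rename P (fun _ => O) HP).
    + exact (sigma_rename _ (fun _ => O) HN).
    + apply (delta_iff (fun e => e O is_in X)); [|definable0].
      intro e; rewrite HX; split; apply Hsup; intros [|i] Hi; trivial;
        now apply Nat.succ_lt_mono, Nat.nlt_0_r in Hi.
  - (* Merge the first two variables into one that ranges over pairs. *)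
    pose (merged := fun (P : (nat -> num M) -> Prop) e =>
      exists x y, e O = pair x y /\ P (scons x (scons y (fun i => e (S i))))).
    assert (Hmerged : forall P, sigma P -> sigma (merged P)).
    { clear P Hsup HP HN; intros P HP; unfold merged; apply sigma_ex, sigma_ex, sigma_and.
      - apply delta_sigma; unfold pair; definable0.
      - apply (sigma_rename P (fun i => match i with
          | O => S O | S O => O | S (S j) => S (S (S j)) end)) in HP.
        revert HP; apply sigma_iff; intro e.
        replace (scons (e (S O)) (scons (e O) (fun i => e (S (S (S i))))))
          with (fun i => e match i with O => S O | S O => O | S (S j) => S (S (S j)) end);
          [tauto|].
        apply functional_extensionality; now intros [|[|i]]. }
    assert (D : delta (merged P)).
    { apply IH.
      - intros e e' He (x & y & E & H); exists x, y; split.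
        + rewrite <- E; symmetry; apply He; apply Nat.lt_0_succ.
        + revert H; apply Hsup; intros [|[|i]] Hi; simpl; trivial.
          now apply He, Nat.succ_lt_mono.
      - now apply Hmerged.
      - apply (sigma_iff (fun e =>
          (forall x, x < e O + 1 -> forall y, y < e O + 1 -> e O <> pair x y) \/
          merged (fun e => ~ P e) e)).
        + intro e; split.
          * intros [H|(x & y & E & H)] (x' & y' & E' & H').
            -- apply (H x') with y'; trivial; apply lt_succ_le; rewrite E';
                 auto using le_pair_l, le_pair_r.
            -- rewrite E in E'; apply pair_inj in E' as [-> ->]; auto.
          * intros H; apply NNPP; intro N; apply N; left.
            intros x _ y _ E; apply N; right; exists x, y; split; trivial.
            intro H'; apply H; now exists x, y.
        + apply sigma_or; [apply delta_sigma; unfold pair; definable0 | now apply Hmerged]. }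
    assert (D' := delta_poly_subst _ D (fun i => match i with
      | O => fun e => pair (e O) (e (S O)) | S j => fun e => e (S (S j)) end)).
    refine (delta_iff _ _ _ (D' _)).
    + intro e; cbn beta iota.
      assert (E : scons (e O) (scons (e (S O)) (fun i => e (S (S i)))) = e)
        by (apply functional_extensionality; now intros [|[|i]]).
      split.
      * intros (x & y & E' & H); apply pair_inj in E' as [<- <-]; now rewrite E in H.
      * intro H; exists (e O), (e (S O)); split; trivial; now rewrite E.
    + intros [|j]; unfold pair; polynomial.
Qed.

Lemma delta_of_sigma P : sigma P -> sigma (fun e => ~ P e) -> delta P.
Proof.
  intros HP; assert (HP' := HP); destruct HP' as (R & HR & HPR).
  destruct (delta_finite_support _ HR) as [n Hn].
  apply (delta_of_sigma_support n P); trivial.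
  intros e e' He H; apply HPR in H as [x Hx]; apply HPR; exists x.
  apply (Hn (scons x e) (scons x e')); trivial.
  intros [|i] Hi; simpl; trivial; apply He; auto using Nat.lt_succ_l.
Qed.

Definition recursive (t : (nat -> num M) -> num M) : Prop :=
  delta (fun e => e O = t (fun i => e (S i))).

Lemma recursive_poly t : poly t -> recursive t.
Proof.
  intro Ht; apply delta_poly_eq; [polynomial|].
  apply (poly_subst (fun i e => e (S i))); [intro; polynomial | exact Ht].
Qed.

(** Both [P (t e)] and its negation are Sigma01, as the value of [t] may be
    guessed and then verified. *)
Lemma delta_subst (P : num M -> (nat -> num M) -> Prop) t :
  recursive t -> delta (fun e => P (e O) (fun i => e (S i))) ->
  delta (fun e => P (t e) e).
Proof.
  intros Ht HP; apply delta_of_sigma.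
  - apply (sigma_iff (fun e => exists y, y = t e /\ P y e)).
    + intro e; split; [intros (y & -> & H); exact H | eauto].
    + apply sigma_ex, delta_sigma, delta_and; assumption.
  - apply (sigma_iff (fun e => exists y, y = t e /\ ~ P y e)).
    + intro e; split; [intros (y & -> & H); exact H | eauto].
    + apply sigma_ex, delta_sigma, delta_and; [|apply delta_not]; assumption.
Qed.

Lemma recursive_rename t (r : nat -> nat) :
  recursive t -> recursive (fun e => t (fun i => e (r i))).
Proof.
  exact (delta_rename _ (fun i => match i with O => O | S j => S (r j) end)).
Qed.

Lemma recursive_subst (h : num M -> (nat -> num M) -> num M) t :
  recursive (fun e => h (e O) (fun i => e (S i))) -> recursive t ->
  recursive (fun e => h (t e) e).
Proof.
  intros Hh Ht.
  apply (delta_subst (fun y e => e O = h y (fun i => e (S i))) (fun e => t (fun i => e (S i)))).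
  - now apply recursive_rename.
  - exact (delta_rename _ (fun i => match i with O => S O | S O => O | j => j end) Hh).
Qed.

Lemma recursive_app1 (h : num M -> num M) s :
  recursive (fun e => h (e O)) -> recursive s -> recursive (fun e => h (s e)).
Proof. exact (recursive_subst (fun x _ => h x) s). Qed.

Lemma recursive_app2 (h : num M -> num M -> num M) s t :
  recursive (fun e => h (e O) (e (S O))) -> recursive s -> recursive t ->
  recursive (fun e => h (s e) (t e)).
Proof.
  intros Hh Hs Ht; apply (recursive_subst (fun x e => h x (t e)) s); [|exact Hs].
  apply (recursive_subst (fun y e => h (e O) y) (fun e => t (fun i => e (S i)))).
  - exact (recursive_rename _ (fun i => match i with O => S O | _ => O end) Hh).
  - now apply recursive_rename.
Qed.

Lemma delta_app1 (P : num M -> Prop) s :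
  delta (fun e => P (e O)) -> recursive s -> delta (fun e => P (s e)).
Proof. intros HP Hs; now apply (delta_subst (fun x _ => P x) s). Qed.

Lemma delta_app2 (P : num M -> num M -> Prop) s t :
  delta (fun e => P (e O) (e (S O))) -> recursive s -> recursive t ->
  delta (fun e => P (s e) (t e)).
Proof.
  intros HP Hs Ht; apply (delta_subst (fun x e => P x (t e)) s); [exact Hs|].
  apply (delta_subst (fun y e => P (e O) y) (fun e => t (fun i => e (S i)))).
  - now apply recursive_rename.
  - exact (delta_rename _ (fun i => match i with O => S O | _ => O end) HP).
Qed.

Lemma delta_eq s t : recursive s -> recursive t -> delta (fun e => s e = t e).
Proof. apply (delta_app2 (fun x y => x = y)); definable0. Qed.

Lemma delta_lt s t : recursive s -> recursive t -> delta (fun e => s e < t e).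
Proof. apply (delta_app2 (fun x y => x < y)); definable0. Qed.

Lemma delta_mem s X : recursive s -> delta (fun e => s e is_in X).
Proof. apply (delta_app1 (fun x => x is_in X)); definable0. Qed.

Lemma delta_ex t (P : num M -> (nat -> num M) -> Prop) :
  recursive t -> delta (fun e => P (e O) (fun i => e (S i))) ->
  delta (fun e => exists x, x < t e /\ P x e).
Proof.
  intros Ht HP; apply (delta_subst (fun b e => exists x, x < b /\ P x e)); [exact Ht|].
  apply delta_poly_ex; [polynomial|].
  exact (delta_rename _ (fun i => match i with O => O | S j => S (S j) end) HP).
Qed.

Lemma delta_all t (P : num M -> (nat -> num M) -> Prop) :
  recursive t -> delta (fun e => P (e O) (fun i => e (S i))) ->
  delta (fun e => forall x, x < t e -> P x e).
Proof.
  intros Ht HP; apply (delta_subst (fun b e => forall x, x < b -> P x e)); [exact Ht|].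
  apply delta_poly_all; [polynomial|].
  exact (delta_rename _ (fun i => match i with O => O | S j => S (S j) end) HP).
Qed.

Lemma recursive_add s t : recursive s -> recursive t -> recursive (fun e => s e + t e).
Proof. apply recursive_app2, recursive_poly; polynomial. Qed.

Lemma recursive_mul s t : recursive s -> recursive t -> recursive (fun e => s e * t e).
Proof. apply recursive_app2, recursive_poly; polynomial. Qed.

Lemma recursive_pair s t : recursive s -> recursive t -> recursive (fun e => pair (s e) (t e)).
Proof. apply recursive_app2, recursive_poly; unfold pair; polynomial. Qed.

Lemma recursive_var i : recursive (fun e => e i).
Proof. apply recursive_poly; polynomial. Qed.

Lemma recursive_const a : recursive (fun _ => a).
Proof. apply recursive_poly; polynomial. Qed.

(** The hooks are extended with each predicate and function shown to be
    definable. *)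
Ltac delta_hook := fail.
Ltac recursive_hook := fail.

Ltac definable :=
  cbn beta iota; lazymatch goal with
  | |- recursive _ => first
    [ eassumption
    | apply recursive_const
    | apply recursive_var
    | apply recursive_add; definable
    | apply recursive_mul; definable
    | apply recursive_pair; definable
    | match goal with
      | H : recursive (fun e => ?h (e O)) |- recursive (fun e => ?h (@?s e)) =>
        apply (recursive_app1 h s H)
      | H : recursive (fun e => ?h (e O) (e (S O)))
        |- recursive (fun e => ?h (@?s e) (@?t e)) =>
        apply (recursive_app2 h s t H)
      end; definable
    | recursive_hook; definable ]
  | |- delta _ => first
    [ eassumption
    | apply delta_const
    | apply delta_eq; definable
    | apply delta_lt; definable
    | apply delta_mem; definable
    | apply delta_not; definable
    | apply delta_equiv; definable
    | apply delta_and; definable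
    | apply delta_or; definable
    | apply delta_ex; [definable | definable]
    | apply delta_all; [definable | definable]
    | apply delta_imp; definable
    | match goal with
      | H : delta (fun e => ?P (e O)) |- delta (fun e => ?P (@?s e)) =>
        apply (delta_app1 P s H)
      | H : delta (fun e => ?P (e O) (e (S O)))
        |- delta (fun e => ?P (@?s e) (@?t e)) =>
        apply (delta_app2 P s t H)
      end; definable
    | delta_hook; definable ]
  | |- sigma _ => first
    [ eassumption
    | apply delta_sigma; definable
    | apply sigma_and; definable
    | apply sigma_or; definable
    | apply sigma_ex; definable ]
  end.

Lemma least_number (P : num M -> Prop) n : delta (fun e => P (e O)) -> P n ->
  exists m, P m /\ forall k, k < m -> ~ P k.
Proof.
  intros HP Hn; apply NNPP; intro N.
  assert (A : forall m, forall k, k < m -> ~ P k).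
  { intro m; induct m by definable.
    - intros k Hk; now apply (not_lt0 M HM) in Hk.
    - intros k Hk Pk; apply lt_succ_le in Hk as [Hk| ->]; [now apply (IH k)|].
      apply N; eauto. }
  apply (A (n + 1) n); trivial; apply lt_succ_le, le_refl.
Qed.

(** A counterexample at [n] would propagate downwards to [0]: by Sigma01
    induction on [j] there is one at [n - j]. *)
Lemma pi_induction (R : num M -> num M -> Prop) : delta (fun e => R (e O) (e (S O))) ->
  (forall a, R 0 a) -> (forall n, (forall a, R n a) -> forall a, R (n + 1) a) ->
  forall n a, R n a.
Proof.
  intros HR H0 HS n; apply NNPP; intro Hn.
  assert (A : forall j, exists i, i + j = n /\ exists a, ~ R i a).
  { refine (sigma_induction _ _ _ _).
    - definable.
    - exists n; split; [ring|]; apply NNPP; intro N; apply Hn; intro a.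
      apply NNPP; eauto.
    - intros j (i & E & a & Ha); destruct (zero_or_succ i) as [->|[k ->]];
        [destruct Ha; trivial|].
      exists k; split; [rewrite <- E; ring|].
      apply NNPP; intro N; apply Ha, HS; intro b; apply NNPP; eauto. }
  destruct (A (n + 1)) as (i & E & _).
  apply (no_lt_self _ _ i (eq_le _ _ E)); ring.
Qed.

Lemma delta_comprehension (P : num M -> Prop) : delta (fun e => P (e O)) ->
  exists X : sets M, forall n, n is_in X <-> P n.
Proof. intro HP; apply sigma_comprehension; apply delta_sigma; definable. Qed.


(** * Coding bounded sets *)

Lemma divides_mul_r (d a b : num M) : divides d a -> divides d (a * b).
Proof. intros [q ->]; exists (q * b); ring. Qed.

Lemma divides_mul_l (d a b : num M) : divides d b -> divides d (a * b).
Proof. intros [q ->]; exists (a * q); ring. Qed.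

Lemma divides_sub (d a b : num M) : divides d a -> divides d (a + b) -> divides d b.
Proof.
  intros [q ->] [r E]; destruct (le_or_lt q r) as [H|H].
  - apply le_exists in H as [c ->]; exists c.
    apply (add_cancel_l _ _ (d * q)); rewrite E; ring.
  - apply lt_exists in H as [c ->]; exists 0.
    destruct (zero_or_succ b) as [->|[x ->]]; [ring|exfalso].
    apply (no_lt_self _ _ (d * c + d + x) (eq_le _ _ E)); ring.
Qed.

Lemma divides_bounded (d n : num M) : divides d n <-> exists q, q < n + 1 /\ n = d * q.
Proof.
  split; [|intros (q & _ & H); now exists q].
  intros [q ->]; destruct (zero_or_succ d) as [->|[c ->]].
  - exists 0; split; [apply lt_succ_le, le_zero | ring].
  - exists q; split; trivial; apply (lt_intro _ _ (c * q)); ring.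
Qed.

Lemma delta_divides s t : recursive s -> recursive t -> delta (fun e => divides (s e) (t e)).
Proof.
  intros; apply (delta_iff (fun e => exists q, q < t e + 1 /\ t e = s e * q)).
  - intro; now rewrite divides_bounded.
  - apply (delta_app2 (fun x y => exists q, q < y + 1 /\ y = x * q)); definable.
Qed.

Ltac delta_hook ::= apply delta_divides.

Definition modulus (m i : num M) : num M := m * (i + 1) + 1.

Lemma recursive_modulus s t :
  recursive s -> recursive t -> recursive (fun e => modulus (s e) (t e)).
Proof. intros; unfold modulus; definable. Qed.

Ltac recursive_hook ::= apply recursive_modulus.

(** [modulus m i * x] is a multiple of [m * x], plus [x]. *)
Lemma modulus_coprime_base (m i x : num M) :
  divides (modulus m i) (m * x) -> divides (modulus m i) x.
Proof.
  intro H; apply (divides_sub _ (m * x * (i + 1))); [now apply divides_mul_r|].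
  exists x; unfold modulus; ring.
Qed.

(** Two moduli differ by [m] times the difference of their indices, and both
    factors divide a power of [m]. *)
Lemma moduli_coprime (m d i j x : num M) :
  (forall k, k < d -> divides (k + 1) m) -> i < d -> j < d -> i <> j ->
  divides (modulus m i) (modulus m j * x) -> divides (modulus m i) x.
Proof.
  intros Hm Hi Hj N H.
  assert (K : forall c, c < d -> divides (modulus m i) (m * ((c + 1) * x)) ->
                        divides (modulus m i) x).
  { intros c Hc D; destruct (Hm c Hc) as [u E].
    apply modulus_coprime_base.
    replace (m * x) with (u * ((c + 1) * x)) by (rewrite E; ring).
    now apply divides_mul_l, modulus_coprime_base. }
  destruct (lt_trichotomy i j) as [L|[L|L]]; [|contradiction|];
    apply lt_exists in L as [c ->]; apply (K c).
  - linear (Hj, le_zero i).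
  - apply (divides_sub _ (modulus m i * x)); [now apply divides_mul_r; exists 1; ring|].
    revert H; unfold modulus; now replace ((m * (i + c + 1 + 1) + 1) * x)
      with ((m * (i + 1) + 1) * x + m * ((c + 1) * x)) by ring.
  - linear (Hi, le_zero j).
  - apply (divides_sub _ _ _ H).
    exists x; unfold modulus; ring.
Qed.

(** The code is the least common multiple of the moduli with index in [A].  Were
    it divisible by another modulus, then dividing by that modulus would leave a
    smaller common multiple.  Being least, it is bounded by [p], whatever
    [A] is. *)
Lemma bounded_set_code (A : num M -> Prop) (d m p : num M) : delta (fun e => A (e O)) ->
  (forall k, k < d -> divides (k + 1) m) -> 0 < m ->
  (forall i, i < d -> divides (modulus m i) p) -> 0 < p ->
  exists n, n <= p /\ forall i, i < d -> (divides (modulus m i) n <-> A i).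
Proof.
  intros HA Hm m_pos Hp p_pos.
  destruct (least_number
    (fun n => 0 < n /\ forall i, i < d -> A i -> divides (modulus m i) n) p)
    as (n & [n_pos Hn] & Hmin).
  - definable.
  - auto.
  - exists n; split; [apply not_lt; intro H; apply (Hmin p); auto|].
    intros i Hi; split; [|auto].
    intros [n' E]; apply NNPP; intro N; apply (Hmin n').
    + apply lt_exists in m_pos as [a ->].
      destruct (zero_or_succ n') as [->|[b ->]].
      * rewrite E in n_pos; unfold modulus in n_pos; exfalso; linear n_pos.
      * rewrite E; apply (lt_intro _ _ ((a * i + a + i) * (b + 1) + b)).
        unfold modulus; ring.
    + split.
      * destruct (zero_or_succ n') as [->|[b ->]]; [|apply (lt_intro _ _ b); ring].
        rewrite E in n_pos; unfold modulus in n_pos; exfalso; linear n_pos.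
      * intros j Hj Aj; apply (moduli_coprime m d j i); auto.
        -- now intros ->.
        -- rewrite <- E; auto.
Qed.

Lemma common_multiple (t : num M -> num M) d : recursive (fun e => t (e O)) ->
  (forall i, 0 < t i) -> exists p, 0 < p /\ forall i, i < d -> divides (t i) p.
Proof.
  intros Ht Hpos; revert d; refine (sigma_induction _ _ _ _).
  - definable.
  - exists 1; split; [apply (lt_intro _ _ 0); ring|].
    intros i Hi; now apply (not_lt0 M HM) in Hi.
  - intros d (p & p_pos & Hp); exists (p * t d); split.
    + specialize (Hpos d); apply lt_exists in p_pos as [a ->], Hpos as [b ->].
      apply (lt_intro _ _ (a * b + a + b)); ring.
    + intros i Hi; apply lt_succ_le in Hi as [Hi| ->].
      * now apply divides_mul_r, Hp.
      * exists p; ring.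
Qed.

(** A Delta01 way of saying that [b] bounds the codes of all strings of length
    [d] (see [string_le_bound]): a direct definition would quantify over all
    strings. *)
Definition string_bound (d b : num M) : Prop :=
  exists m, m < b + 1 /\ exists p, p < b + 1 /\ b = pair d (pair m p) /\
    (forall k, k < d -> divides (k + 1) m) /\ 0 < m /\
    (forall i, i < d -> divides (modulus m i) p) /\ 0 < p.

Lemma delta_string_bound s t :
  recursive s -> recursive t -> delta (fun e => string_bound (s e) (t e)).
Proof. apply delta_app2; unfold string_bound; definable. Qed.

Lemma string_bound_exists d : exists b, string_bound d b.
Proof.
  destruct (common_multiple (fun k => k + 1) d) as (m & m_pos & Hm);
    [definable | intro k; apply (lt_intro _ _ k); ring|].
  destruct (common_multiple (modulus m) d) as (p & p_pos & Hp);
    [definable | intro k; apply (lt_intro _ _ (m * (k + 1))); unfold modulus; ring|].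
  exists (pair d (pair m p)), m.
  assert (H := le_pair_l m p); assert (H' := le_pair_r m p).
  assert (K := le_pair_r d (pair m p)).
  split; [apply lt_succ_le; now apply le_trans with (pair m p)|].
  exists p; split; [apply lt_succ_le; now apply le_trans with (pair m p)|].
  auto.
Qed.

Lemma set_code (A : num M -> Prop) d : delta (fun e => A (e O)) ->
  exists m n, forall i, i < d -> (divides (modulus m i) n <-> A i).
Proof.
  intro HA; destruct (string_bound_exists d) as (b & m & _ & p & _ & _ & Hm & ? & Hp & ?).
  destruct (bounded_set_code A d m p) as (n & _ & Hn); eauto.
Qed.

(** * Recursive functions from graphs and by iteration *)

Definition value (G : num M -> Prop) : num M := epsilon (inhabits 0) G.

Lemma value_spec G : (exists y, G y) -> G (value G).
Proof. apply epsilon_spec. Qed.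

Lemma recursive_value (G : num M -> num M -> Prop) :
  delta (fun e => G (e O) (e (S O))) -> (forall x, exists! y, G x y) ->
  recursive (fun e => value (G (e O))).
Proof.
  intros HG Hex.
  apply (delta_iff (fun e => G (e (S O)) (e O))).
  - intro e; destruct (Hex (e (S O))) as (y & Hy & Huniq).
    assert (V : G (e (S O)) (value (G (e (S O))))) by (apply value_spec; eauto).
    split; [|now intros ->].
    intro H; now rewrite <- (Huniq _ V), <- (Huniq _ H).
  - exact (delta_rename _ (fun i => match i with O => S O | _ => O end) HG).
Qed.

(** A finite set of pairs is a derivation from [s] if each of its elements
    [(i, r)] has a reason to satisfy [r = h^i(s)] within the set. *)
Definition derivation (h : num M -> num M) (s b m n : num M) : Prop :=
  forall i, i < b -> forall r, r < b -> divides (modulus m (pair i r)) n ->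
    i = 0 /\ r = s \/
    exists j, j < i /\ i = j + 1 /\
      exists r', r' < b /\ divides (modulus m (pair j r')) n /\ r = h r'.

Definition derivable (h : num M -> num M) (k s t : num M) : Prop :=
  exists b m n, k < b /\ t < b /\ derivation h s b m n /\
    divides (modulus m (pair k t)) n.

Section Iteration.
Context (h : num M -> num M) (Hh : recursive (fun e => h (e O))).

(** Two derivations of a value for [i + 1] lead back to two derived values for
    [i]; these agree by induction. *)
Lemma derivation_agree s b m n b' m' n' :
  derivation h s b m n -> derivation h s b' m' n' ->
  forall i, i < b -> i < b' -> forall r, r < b -> forall r', r' < b' ->
    divides (modulus m (pair i r)) n -> divides (modulus m' (pair i r')) n' -> r = r'.
Proof.
  intros H H'; refine (delta_induction _ _ _ _); [definable| |].
  - intros Hb Hb' r Hr r' Hr' D D'.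
    destruct (H 0 Hb r Hr D) as [[_ ->]|(j & Hj & _)]; [|now apply (not_lt0 M HM) in Hj].
    destruct (H' 0 Hb' r' Hr' D') as [[_ ->]|(j & Hj & _)]; trivial.
    now apply (not_lt0 M HM) in Hj.
  - intros i IH Hb Hb' r Hr r' Hr' D D'.
    destruct (H _ Hb r Hr D) as [[E _]|(j & _ & E & x & Hx & Dx & ->)];
      [now apply (succ_neq0 M HM) in E | apply (succ_inj M HM) in E as <-].
    destruct (H' _ Hb' r' Hr' D') as [[E _]|(j & _ & E & x' & Hx' & Dx' & ->)];
      [now apply (succ_neq0 M HM) in E | apply (succ_inj M HM) in E as <-].
    f_equal; apply IH; trivial; [linear Hb | linear Hb'].
Qed.

Lemma derivable_unique k s t t' : derivable h k s t -> derivable h k s t' -> t = t'.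
Proof.
  intros (b & m & n & Hk & Ht & H & D) (b' & m' & n' & Hk' & Ht' & H' & D').
  exact (derivation_agree s b m n b' m' n' H H' k Hk Hk' t Ht t' Ht' D D').
Qed.

Lemma derivable_0 s : derivable h 0 s s.
Proof.
  destruct (set_code (fun x => x = pair 0 s) (pair (s + 1) (s + 1))) as (m & n & Hmn);
    [definable|].
  assert (L : forall i, i < s + 1 -> forall r, r < s + 1 ->
    (divides (modulus m (pair i r)) n <-> pair i r = pair 0 s)).
  { intros i Hi r Hr; apply Hmn, pair_lt; linear (Hi, Hr). }
  assert (P0 : 0 < s + 1) by (apply lt_succ_le, le_zero).
  assert (Ps : s < s + 1) by apply lt_succ_le, le_refl.
  exists (s + 1), m, n; do 3 (split; trivial); [|now apply L].
  intros i Hi r Hr D; left; now apply L, pair_inj in D.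
Qed.

(** A derivation is extended by one pair; [c] bounds the entries of
    the old pairs and of the new one. *)
Lemma derivable_succ k s t : derivable h k s t -> derivable h (k + 1) s (h t).
Proof.
  intros (b & m & n & Hk & Ht & H & D).
  pose (c := b + h t + 1 + 1).
  destruct (set_code (fun x => x = pair (k + 1) (h t) \/
      exists i, i < k + 1 /\ exists r, r < b /\ x = pair i r /\ divides (modulus m x) n)
    (pair c c)) as (m' & n' & Hmn).
  { definable. }
  assert (L : forall i, i < c -> forall r, r < c ->
    (divides (modulus m' (pair i r)) n' <->
     i = k + 1 /\ r = h t \/ i < k + 1 /\ r < b /\ divides (modulus m (pair i r)) n)).
  { intros i Hi r Hr; rewrite Hmn by (apply pair_lt; linear (Hi, Hr)); split.
    - intros [E|(i' & Hi' & r' & Hr' & E & D')].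
      + left; now apply pair_inj.
      + right; apply pair_inj in E as [-> ->]; auto.
    - intros [[-> ->]|(Hi' & Hr' & D')]; [now left|right; eauto 10]. }
  assert (Hkc : k + 1 < c) by (unfold c; linear (Hk, le_zero (h t))).
  assert (Htc : h t < c) by (unfold c; linear (le_zero b)).
  assert (Hbc : forall x, x < b -> x < c)
    by (intros x Hx; unfold c; linear (Hx, le_zero (h t))).
  exists c, m', n'; do 3 (split; trivial); [|apply L; auto].
  intros i Hi r Hr D'; apply L in D' as [[-> ->]|(Hi' & Hr' & D')]; trivial.
  - right; exists k; split; [apply lt_succ_le, le_refl|split; trivial].
    exists t; split; [now apply Hbc|split; trivial].
    apply L; auto; right; split; [apply lt_succ_le, le_refl|auto].
  - assert (Hib : i < b) by linear (Hi', Hk).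
    destruct (H i Hib r Hr' D') as [|(j & Hj & E & r' & Hr'' & D'' & E')]; [now left|right].
    exists j; split; trivial; split; trivial; exists r'; split; [now apply Hbc|].
    split; trivial; apply L; [linear (Hj, Hi)|now apply Hbc|right].
    split; [linear (Hj, Hi')|auto].
Qed.

Lemma derivable_total k s : exists t, derivable h k s t.
Proof.
  revert k; refine (sigma_induction _ _ _ _).
  - unfold derivable, derivation; definable.
  - eauto using derivable_0.
  - intros k [t Ht]; eauto using derivable_succ.
Qed.

Definition iter (k s : num M) : num M := value (derivable h k s).

Lemma iter_derivable k s t : derivable h k s t <-> t = iter k s.
Proof.
  assert (D : derivable h k s (iter k s)) 
    by exact (value_spec _ (derivable_total k s)).
  split; [intro H; exact (derivable_unique k s _ _ H D) | now intros ->].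
Qed.

Lemma recursive_iter : recursive (fun e => iter (e O) (e (S O))).
Proof.
  apply delta_of_sigma.
  - apply (sigma_iff (fun e => derivable h (e (S O)) (e (S (S O))) (e O))).
    + intro e; apply iter_derivable.
    + unfold derivable, derivation; definable.
  - apply (sigma_iff (fun e => exists t, derivable h (e (S O)) (e (S (S O))) t /\ e O <> t)).
    + intro e; split; [intros (t & H & N); now apply iter_derivable in H as ->|].
      intro N; exists (iter (e (S O)) (e (S (S O)))); split; trivial; now apply iter_derivable.
    + unfold derivable, derivation; definable.
Qed.

Lemma iter_0 s : iter 0 s = s.
Proof. symmetry; apply iter_derivable, derivable_0. Qed.

Lemma iter_succ k s : iter (k + 1) s = h (iter k s).
Proof. symmetry; apply iter_derivable, derivable_succ; now apply iter_derivable. Qed.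

Lemma iter_succ_in k s : iter (k + 1) s = iter k (h s).
Proof.
  assert (R := recursive_iter).
  induct k by definable; [now rewrite iter_succ, !iter_0|].
  now rewrite iter_succ, IH, <- iter_succ.
Qed.

Lemma iter_add i k s : iter (i + k) s = iter k (iter i s).
Proof.
  assert (R := recursive_iter).
  induct k by definable; [now rewrite (add_0 M HM), iter_0|].
  now rewrite add_assoc, !iter_succ, IH.
Qed.

End Iteration.

(** * Strings *)

Lemma pair3_bounds (k m n : num M) : let s := pair k (pair m n) in
  k < s + 1 /\ m < s + 1 /\ n < s + 1.
Proof.
  cbv zeta; rewrite !lt_succ_le; split; [apply le_pair_l|].
  split; (apply le_trans with (pair m n); [|apply le_pair_r]);
    [apply le_pair_l | apply le_pair_r].
Qed.

Lemma has_length_unique (s k l : num M) : has_length s k -> has_length s l -> k = l.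
Proof. intros (m & n & ->) (m' & n' & E); now apply pair_inj in E. Qed.

Lemma delta_has_length s t :
  recursive s -> recursive t -> delta (fun e => has_length (s e) (t e)).
Proof.
  apply delta_app2.
  apply (delta_iff (fun e => exists m, m < e O + 1 /\ exists n, n < e O + 1 /\
    e O = pair (e (S O)) (pair m n))); [|definable].
  intro e; split.
  - intros (m & _ & n & _ & E); now exists m, n.
  - intros (m & n & E); destruct (pair3_bounds (e (S O)) m n) as (_ & Bm & Bn).
    rewrite <- E in Bm, Bn; eauto 10.
Qed.

Lemma bit_presented (k m n i : num M) :
  bit (pair k (pair m n)) i <-> i < k /\ divides (modulus m i) n.
Proof.
  split.
  - intros (k' & m' & n' & E & H); apply pair_inj in E as [-> E].
    now apply pair_inj in E as [-> ->].
  - now exists k, m, n.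
Qed.

Lemma delta_bit s t : recursive s -> recursive t -> delta (fun e => bit (s e) (t e)).
Proof.
  apply delta_app2.
  apply (delta_iff (fun e => exists k, k < e O + 1 /\ exists m, m < e O + 1 /\
    exists n, n < e O + 1 /\ e O = pair k (pair m n) /\ e (S O) < k /\
    divides (modulus m (e (S O))) n)); [|definable].
  intro e; split.
  - intros (k & _ & m & _ & n & _ & H); now exists k, m, n.
  - intros (k & m & n & E & H); destruct (pair3_bounds k m n) as (Bk & Bm & Bn).
    rewrite <- E in Bk, Bm, Bn; exists k; split; trivial; exists m; split; trivial.
    exists n; auto.
Qed.

Ltac delta_hook ::= first [apply delta_divides | apply delta_has_length | apply delta_bit].

Lemma delta_is_string s : recursive s -> delta (fun e => is_string (s e)).
Proof.
  apply delta_app1.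
  apply (delta_iff (fun e => exists k, k < e O + 1 /\ has_length (e O) k /\
    forall s', s' < e O -> has_length s' k ->
      ~ (forall i, i < k -> (bit s' i <-> bit (e O) i)))).
  - intro e; split; [intros (k & _ & H); now exists k|].
    intros (k & Hk & H); exists k; split; [|now split].
    destruct Hk as (m & n & ->); now apply pair3_bounds.
  - definable.
Qed.

Ltac delta_hook ::=
  first [apply delta_divides | apply delta_has_length | apply delta_bit
        | apply delta_is_string | apply delta_string_bound].

(** Numbers that do not present a string get the length 0. *)
Definition len (s : num M) : num M :=
  value (fun k => has_length s k \/ ~ (exists l, l < s + 1 /\ has_length s l) /\ k = 0).

Lemma has_length_bound (s k : num M) : has_length s k -> k < s + 1.
Proof. intros (m & n & ->); apply pair3_bounds. Qed.

Lemma recursive_len s : recursive s -> recursive (fun e => len (s e)).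
Proof.
  apply recursive_app1; unfold len.
  apply (recursive_value (fun s k => has_length s k \/
    ~ (exists l, l < s + 1 /\ has_length s l) /\ k = 0)); [definable|].
  intro x; destruct (classic (exists l, l < x + 1 /\ has_length x l)) as [(l & Hl & H)|N].
  - exists l; split; [now left|].
    intros k [Hk|[N _]]; [exact (has_length_unique x l k H Hk) | destruct N; eauto].
  - exists 0; split; [now right|].
    intros k [Hk|[_ ->]]; trivial; destruct N; eauto using has_length_bound.
Qed.

Ltac recursive_hook ::= first [apply recursive_modulus | apply recursive_len].

Lemma len_eq s k : has_length s k -> len s = k.
Proof.
  intro H; unfold len.
  set (G := fun k => _); assert (V : G (value G)) by (apply value_spec; exists k; now left).
  destruct V as [V|[N _]]; [exact (has_length_unique s _ _ V H)|].
  destruct N; eauto using has_length_bound.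
Qed.

Lemma string_has_length s : is_string s -> has_length s (len s).
Proof. intros (k & Hk & _); now rewrite (len_eq s k Hk). Qed.

Lemma len_le s : is_string s -> len s <= s.
Proof. intro Hs; apply lt_succ_le, has_length_bound, string_has_length, Hs. Qed.

Lemma bit_lt s i : bit s i -> i < len s.
Proof.
  intros (k & m & n & -> & Hi & _); rewrite (len_eq _ k); trivial; now exists m, n.
Qed.

Lemma string_ext s t : is_string s -> is_string t -> len s = len t ->
  (forall i, i < len s -> (bit s i <-> bit t i)) -> s = t.
Proof.
  intros (k & Hk & Ls) (l & Hl & Lt) E Hb.
  rewrite (len_eq s k Hk), (len_eq t l Hl) in *; subst l.
  destruct (lt_trichotomy s t) as [H|[H|H]]; trivial; exfalso.
  - now apply (Lt s H Hk).
  - apply (Ls t H Hl); intros i Hi; symmetry; auto.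
Qed.

Lemma string_of_presentation s k : has_length s k ->
  exists r, r <= s /\ is_string r /\ len r = k /\ forall i, i < k -> (bit r i <-> bit s i).
Proof.
  intro Hs.
  destruct (least_number
    (fun r => has_length r k /\ forall i, i < k -> (bit r i <-> bit s i)) s)
    as (r & [Hr Br] & Hmin); [definable | split; [exact Hs | tauto]|].
  exists r; split; [|split; [|split]]; trivial; [| |now apply len_eq].
  - apply not_lt; intro H; apply (Hmin s H); split; [exact Hs | tauto].
  - exists k; split; trivial; intros r' Hr' Lr' Br'; apply (Hmin r' Hr').
    split; trivial; intros i Hi; rewrite Br' by exact Hi; auto.
Qed.

(** The uniform bound [b] comes from that of [bounded_set_code]. *)
Lemma string_of_predicate (A : num M -> Prop) d b :
  delta (fun e => A (e O)) -> string_bound d b ->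
  exists s, s <= b /\ is_string s /\ len s = d /\ forall i, i < d -> (bit s i <-> A i).
Proof.
  intros HA (m & _ & p & _ & -> & Hm & m_pos & Hp & p_pos).
  destruct (bounded_set_code A d m p) as (n & Hn & Dn); trivial.
  destruct (string_of_presentation (pair d (pair m n)) d) as (s & Hs & Ss & Ls & Bs);
    [now exists m, n|].
  exists s; split; [|split; [|split]]; trivial.
  - apply le_trans with (1 := Hs); auto using pair_le, le_refl.
  - intros i Hi; rewrite (Bs i Hi), bit_presented, (Dn i Hi); tauto.
Qed.

Lemma string_le_bound s b : is_string s -> string_bound (len s) b -> s <= b.
Proof.
  intros Hs Hb; destruct (string_of_predicate (bit s) (len s) b) as (t & Ht & St & Lt & Bt);
    trivial; [definable|].
  assert (t = s) as <-; trivial.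
  apply string_ext; trivial; now rewrite Lt.
Qed.

Lemma prefix_elim (s t : num M) : prefix s t ->
  len s <= len t /\ forall i, i < len s -> (bit s i <-> bit t i).
Proof. intros (k & l & Hk & Hl & H); now rewrite (len_eq s k Hk), (len_eq t l Hl). Qed.

Lemma prefix_intro (s t : num M) : is_string s -> is_string t -> len s <= len t ->
  (forall i, i < len s -> (bit s i <-> bit t i)) -> prefix s t.
Proof. exists (len s), (len t); auto using string_has_length. Qed.

Lemma delta_prefix s t : recursive s -> recursive t -> delta (fun e => prefix (s e) (t e)).
Proof.
  apply delta_app2.
  apply (delta_iff (fun e => has_length (e O) (len (e O)) /\ has_length (e (S O)) (len (e (S O)))
    /\ len (e O) <= len (e (S O)) /\
    forall i, i < len (e O) -> (bit (e O) i <-> bit (e (S O)) i))); [|definable].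
  intro e; split; [intro H; now exists (len (e O)), (len (e (S O)))|].
  intro H; assert (H' := prefix_elim _ _ H); destruct H as (k & l & Hk & Hl & _).
  now rewrite (len_eq _ _ Hk), (len_eq _ _ Hl) in *.
Qed.

Lemma prefix_trans (s t u : num M) : is_string s -> is_string u ->
  prefix s t -> prefix t u -> prefix s u.
Proof.
  intros Hs Hu [L1 B1]%prefix_elim [L2 B2]%prefix_elim; apply prefix_intro; trivial.
  - eauto using le_trans.
  - intros i Hi; rewrite (B1 i Hi); apply B2; eauto using lt_le_trans.
Qed.

Lemma prefix_of_common (s t u : num M) : is_string s -> is_string t ->
  prefix s u -> prefix t u -> len s <= len t -> prefix s t.
Proof.
  intros Hs Ht [L1 B1]%prefix_elim [L2 B2]%prefix_elim L; apply prefix_intro; trivial.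
  intros i Hi; rewrite (B1 i Hi); symmetry; apply B2; eauto using lt_le_trans.
Qed.

Lemma prefix_flip (s t : num M) : is_string s -> is_string t ->
  prefix s t -> len t <= len s -> prefix t s.
Proof.
  intros Hs Ht [L B]%prefix_elim L'; apply prefix_intro; trivial.
  intros i Hi; symmetry; apply B; eauto using lt_le_trans.
Qed.

Lemma truncation s c : is_string s -> c <= len s ->
  exists r, is_string r /\ len r = c /\ prefix r s.
Proof.
  intros Hs Hc; destruct (string_bound_exists c) as [b Hb].
  destruct (string_of_predicate (bit s) c b) as (r & _ & Sr & Lr & Br);
    [definable | exact Hb|].
  exists r; split; [|split]; trivial; apply prefix_intro; rewrite ?Lr; auto.
Qed.

Lemma prefix_of_set_elim (s : num M) X : prefix_of_set s X ->
  forall i, i < len s -> (bit s i <-> i is_in X).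
Proof. intros (k & Hk & H); now rewrite (len_eq s k Hk). Qed.

Lemma prefix_of_set_intro (s : num M) X : is_string s ->
  (forall i, i < len s -> (bit s i <-> i is_in X)) -> prefix_of_set s X.
Proof. exists (len s); auto using string_has_length. Qed.

Lemma prefix_of_set_trans (s t : num M) X : is_string s -> prefix s t -> prefix_of_set t X ->
  prefix_of_set s X.
Proof.
  intros Hs [L B]%prefix_elim H; apply prefix_of_set_intro; trivial.
  intros i Hi; rewrite (B i Hi); apply (prefix_of_set_elim t X H); eauto using lt_le_trans.
Qed.

Lemma restriction_iff X (n s : num M) :
  restriction X n s <-> is_string s /\ len s = n /\ prefix_of_set s X.
Proof.
  split; intros (H1 & H2 & H3); split; trivial; split; trivial; [now apply len_eq|].
  rewrite <- H2; auto using string_has_length.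
Qed.

Lemma restriction_prefix X (m n s t : num M) : restriction X m s -> restriction X n t -> m <= n ->
  prefix s t.
Proof.
  rewrite !restriction_iff; intros (Hs & <- & Bs) (Ht & <- & Bt) L.
  apply prefix_intro; trivial; intros i Hi.
  rewrite (prefix_of_set_elim s X Bs i Hi); symmetry.
  apply (prefix_of_set_elim t X Bt); eauto using lt_le_trans.
Qed.

Lemma delta_restriction X s t :
  recursive s -> recursive t -> delta (fun e => restriction X (s e) (t e)).
Proof.
  apply (delta_app2 (restriction X)).
  apply (delta_iff (fun e => is_string (e (S O)) /\ len (e (S O)) = e O /\
    forall i, i < len (e (S O)) -> (bit (e (S O)) i <-> i is_in X))); [|definable].
  intro e; rewrite restriction_iff; split; intros (H1 & H2 & H3); split; trivial; split; trivial.
  - now apply prefix_of_set_intro.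
  - now apply prefix_of_set_elim.
Qed.

Ltac delta_hook ::=
  first [apply delta_divides | apply delta_has_length | apply delta_bit
        | apply delta_is_string | apply delta_string_bound | apply delta_prefix
        | apply delta_restriction].

(** * Uniform return times *)

Definition pow3 (s : num M) : num M := iter (fun x => x + x + x) s 1.

Lemma recursive_pow3 s : recursive s -> recursive (fun e => pow3 (s e)).
Proof.
  assert (R := recursive_iter (fun x => x + x + x)).
  assert (R' := R ltac:(definable)).
  apply recursive_app1; unfold pow3; definable.
Qed.

Ltac recursive_hook ::=
  first [apply recursive_modulus | apply recursive_len | apply recursive_pow3].

Lemma pow3_0 : pow3 0 = 1.
Proof. apply iter_0; definable. Qed.

Lemma pow3_succ s : pow3 (s + 1) = pow3 s + pow3 s + pow3 s.
Proof. apply (iter_succ (fun x => x + x + x)); definable. Qed.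

(** This is what absorbs the delay [s] in the step of [uniform_returns]: an
    interval of length [3^s] delayed by [s] ends before twice [3^s]. *)
Lemma lt_pow3 s : s < pow3 s.
Proof.
  induct s by definable; [rewrite pow3_0; linear (le_zero 0)|].
  rewrite pow3_succ; linear (IH, IH, le_zero (pow3 s), le_zero s).
Qed.

(** The lower bound [s] on [k] forces late returns, and the upper bound makes
    the condition bounded. *)
Definition returns (Q : num M -> num M -> Prop) (s i : num M) : Prop :=
  Q s i -> exists k, k < s + pow3 s + 1 /\ s <= k /\ Q s (i + k).

(** [Q s i] is to be read as: the point [x_i] of an orbit extends [s].  Either an
    [i] that is good below [s] is good for [s] too, or [Q s] fails throughout
    the interval from [i + s] of length [3^s], where any [j] that is good below
    [s] is good for [s] because nothing is asked of it. *)
Lemma uniform_returns (Q : num M -> num M -> Prop) :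
  delta (fun e => Q (e O) (e (S O))) ->
  forall s a, exists i, i < a + pow3 s /\ a <= i /\ forall s', s' < s -> returns Q s' i.
Proof.
  intro HQ; refine (pi_induction _ _ _ _).
  - unfold returns; definable.
  - intro a; exists a; rewrite pow3_0; split; [apply lt_succ_le, le_refl|].
    split; [apply le_refl|]; intros s' H; now apply (not_lt0 M HM) in H.
  - intros s IH a; rewrite pow3_succ.
    assert (Hs := lt_pow3 s); assert (H0 := le_zero (pow3 s)).
    destruct (IH a) as (i & Hi & Ha & Ri).
    destruct (classic (returns Q s i)) as [R|N].
    { exists i; split; [linear (Hi, H0, H0)|split; trivial].
      intros s' H; apply lt_succ_le in H as [H| ->]; auto. }
    destruct (IH (i + s)) as (j & Hj & Hij & Rj).
    exists j; split; [linear (Hj, Hi, Hs)|split; [linear (Hij, Ha, le_zero s)|]].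
    intros s' H; apply lt_succ_le in H as [H| ->]; auto.
    intro Qj; exfalso; apply N; intros _.
    apply le_exists in Hij as [c ->]; exists (s + c); split; [|split].
    + linear Hj.
    + apply le_add.
    + now rewrite add_assoc.
Qed.

(** * Systems *)

(** The value outside of strings only serves to make the function total. *)
Definition image (f : sets M) (s : num M) : num M :=
  value (fun t => is_string s /\ pair s t is_in f \/ ~ is_string s /\ t = s).

Section System.
Context (f : sets M) (Hf : encodes_transformation f).

Lemma image_graph s t : is_string s -> (pair s t is_in f <-> t = image f s).
Proof.
  destruct Hf as [[_ F] _]; intro Hs; destruct (F s Hs) as (y & Hy & U).
  assert (V : pair s (image f s) is_in f).
  { destruct (value_spec (fun t => is_string s /\ pair s t is_in f \/ ~ is_string s /\ t = s))
      as [[_ H]|[H _]]; [now exists y; left|exact H|contradiction]. }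
  split; [intro H; now rewrite <- (U _ V), <- (U _ H) | now intros ->].
Qed.

Lemma recursive_image : recursive (fun e => image f (e O)).
Proof.
  apply (recursive_value (fun s t => is_string s /\ pair s t is_in f \/ ~ is_string s /\ t = s));
    [definable|].
  intro s; destruct (classic (is_string s)) as [Hs|N].
  - exists (image f s); split; [left; split; trivial; now apply image_graph|].
    intros t [[_ H]|[N _]]; [symmetry; now apply image_graph | contradiction].
  - exists s; split; [now right|]; now intros t [[H _]|[_ ->]].
Qed.

Lemma image_string s : is_string s -> is_string (image f s).
Proof.
  intro Hs; destruct Hf as [[F _] _].
  destruct (F (pair s (image f s))) as (x & y & _ & Hy & E); [now apply image_graph|].
  now apply pair_inj in E as [_ ->].
Qed.

Lemma image_prefix s t : is_string s -> is_string t -> prefix s t ->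
  prefix (image f s) (image f t).
Proof. intros Hs Ht; apply Hf; now apply image_graph. Qed.

Definition orbit (k s : num M) : num M := iter (image f) k s.

Lemma recursive_orbit s t :
  recursive s -> recursive t -> recursive (fun e => orbit (s e) (t e)).
Proof. apply recursive_app2; exact (recursive_iter _ recursive_image). Qed.

Ltac recursive_hook ::= first [apply recursive_modulus | apply recursive_len
  | apply recursive_pow3 | apply recursive_orbit].

Lemma orbit_0 s : orbit 0 s = s.
Proof. exact (iter_0 _ recursive_image s). Qed.

Lemma orbit_succ k s : orbit (k + 1) s = image f (orbit k s).
Proof. exact (iter_succ _ recursive_image k s). Qed.

Lemma orbit_string k s : is_string s -> is_string (orbit k s).
Proof.
  intro Hs; induct k by definable; [now rewrite orbit_0|].
  rewrite orbit_succ; now apply image_string.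
Qed.

Lemma orbit_prefix k s t : is_string s -> is_string t -> prefix s t ->
  prefix (orbit k s) (orbit k t).
Proof.
  intros Hs Ht Hst; induct k by definable; [now rewrite !orbit_0|].
  rewrite !orbit_succ; apply image_prefix; auto using orbit_string.
Qed.

(** This is the continuity of the iterates, uniformly for all [i <= k].  Quantified
    over all strings it would need too much induction; restricted to strings of
    length [w] below a [string_bound] it is Sigma01, and monotonicity
    yields the longer strings.  In the step, [w] for [k] is fed to
    the modulus of continuity of [f]. *)
Lemma orbit_length c k : exists w, forall s, is_string s -> w <= len s ->
  forall i, i < k + 1 -> c <= len (orbit i s).
Proof.
  assert (A : exists w b, string_bound w b /\ forall s, s < b + 1 ->
    is_string s -> len s = w -> forall i, i < k + 1 -> c <= len (orbit i s)).
  { revert k; refine (sigma_induction _ _ _ _); [definable| |].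
    - destruct (string_bound_exists c) as [b Hb]; exists c, b; split; trivial.
      intros s _ _ <- i Hi; apply lt_succ_le in Hi as [Hi| ->];
        [now apply (not_lt0 M HM) in Hi|rewrite orbit_0; apply le_refl].
    - intros k (w & b & Hb & H); destruct Hf as (_ & _ & Hmod & _).
      destruct (Hmod w) as [m Hm]; destruct (string_bound_exists (m + c)) as [b' Hb'].
      (* The summand [c] is for the iterate [i = 0]. *)
      exists (m + c), b'; split; trivial; intros s _ Hs Ls i Hi.
      destruct (zero_or_succ i) as [->|[j ->]].
      { rewrite orbit_0, Ls; linear (le_zero m). }
      destruct (truncation s m Hs) as (r & Hr & Lr & Prs); [rewrite Ls; apply le_add|].
      assert (Lw : w <= len (image f s)).
      { apply le_trans with (len (image f r)).
        - apply (Hm r (image f r)); [rewrite <- Lr; now apply string_has_length| |].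
          + now apply image_graph.
          + now apply string_has_length, image_string.
        - apply prefix_elim, image_prefix; trivial. }
      destruct (truncation (image f s) w (image_string s Hs) Lw) as (u & Hu & Lu & Pu).
      unfold orbit; rewrite (iter_succ_in _ recursive_image); fold (orbit j (image f s)).
      apply le_trans with (len (orbit j u)).
      + apply H; trivial; [|linear Hi].
        apply lt_succ_le, string_le_bound; [exact Hu | now rewrite Lu].
      + apply prefix_elim, orbit_prefix; auto using image_string. }
  destruct A as (w & b & Hb & H); exists w; intros s Hs Lw i Hi.
  destruct (truncation s w Hs Lw) as (r & Hr & Lr & Pr).
  apply le_trans with (len (orbit i r)).
  - apply H; trivial; apply lt_succ_le, string_le_bound; [exact Hr | now rewrite Lr].
  - now apply prefix_elim, orbit_prefix.
Qed.

Lemma iterate_orbit k s : is_string s -> iterate f k s (orbit k s).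
Proof.
  intro Hs.
  destruct (delta_comprehension (fun z => exists i, i < z + 1 /\ z = pair i (orbit i s)))
    as [g Hg]; [definable|].
  assert (L : forall i r, pair i r is_in g <-> r = orbit i s).
  { intros i r; rewrite Hg; split.
    - intros (j & _ & E); now apply pair_inj in E as [-> ->].
    - intros ->; exists i; split; trivial; apply lt_succ_le, le_pair_l. }
  exists g; split; [split|split; [|split]].
  - intros z Hz; apply Hg in Hz as (i & _ & ->); exists i, (orbit i s).
    split; trivial; split; trivial; now apply orbit_string.
  - intros i _; exists (orbit i s); split; [now apply L|].
    intros r Hr; symmetry; now apply L.
  - apply L; symmetry; apply orbit_0.
  - intros i r r' Hr Hr'; apply L in Hr as ->; apply L in Hr' as ->.
    apply image_graph; [now apply orbit_string | apply orbit_succ].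
  - now apply L.
Qed.

(** [Y] is Delta01: its elements and its non-elements are both recognized from a
    sufficiently long restriction of [X], by [orbit_length], and all
    restrictions agree. *)
Lemma iterated_image_exists k X : (forall n, exists s, restriction X n s) ->
  exists Y, iterated_image f k X Y /\
    forall l s r, restriction X l s -> is_string r -> prefix r (orbit k s) ->
      prefix_of_set r Y.
Proof.
  intro HX.
  assert (Hagree : forall l l' s s' i, restriction X l s -> restriction X l' s' ->
    l <= l' -> i < len (orbit k s) -> (bit (orbit k s) i <-> bit (orbit k s') i)).
  { intros l l' s s' i Hs Hs' L Hi.
    assert (P := restriction_prefix X l l' s s' Hs Hs' L).
    apply restriction_iff in Hs as (Hs & _), Hs' as (Hs' & _).
    now apply prefix_elim; [apply orbit_prefix|]. }
  assert (Hagree' : forall l l' s s' i, restriction X l s -> restriction X l' s' ->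
    i < len (orbit k s) -> i < len (orbit k s') -> (bit (orbit k s) i <-> bit (orbit k s') i)).
  { intros l l' s s' i Hs Hs' Hi Hi'; destruct (le_or_lt l l') as [L|L]; [eauto|].
    symmetry; apply lt_le in L; eauto. }
  destruct (sigma_comprehension (fun i => exists l s, restriction X l s /\ bit (orbit k s) i))
    as [Y HY]; [definable| |].
  { apply (sigma_iff (fun e => exists l s, restriction X l s /\
      e O < len (orbit k s) /\ ~ bit (orbit k s) (e O))); [|definable].
    intro e; split.
    - intros (l & s & Hs & Hi & N) (l' & s' & Hs' & B); apply N.
      apply (Hagree' l l' s s'); trivial; now apply bit_lt.
    - intro N; destruct (orbit_length (e O + 1) k) as [w Hw].
      destruct (HX w) as [s Hs]; exists w, s; split; trivial; split.
      + apply lt_le_succ; apply restriction_iff in Hs as (Hs & Ls & _).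
        apply Hw; [exact Hs | rewrite Ls; apply le_refl | apply lt_succ_le, le_refl].
      + intro B; apply N; eauto. }
  assert (HYs : forall l s, restriction X l s -> prefix_of_set (orbit k s) Y).
  { intros l s Hs; assert (Ss := proj1 (proj1 (restriction_iff _ _ _) Hs)).
    apply prefix_of_set_intro; [now apply orbit_string|].
    intros i Hi; rewrite HY; split; [eauto|].
    intros (l' & s' & Hs' & B); apply (Hagree' l l' s s'); trivial; now apply bit_lt. }
  exists Y; split; [|intros; eapply prefix_of_set_trans; eauto].
  intro c; destruct (orbit_length c k) as [w Hw]; destruct (HX w) as [s Hs].
  assert (Hs' := proj1 (restriction_iff _ _ _) Hs); destruct Hs' as (Ss & Ls & _).
  destruct (truncation (orbit k s) c) as (r & Sr & Lr & Pr);
    [now apply orbit_string|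
     apply Hw; [exact Ss | rewrite Ls; apply le_refl | apply lt_succ_le, le_refl]|].
  exists r; split.
  - apply restriction_iff; split; trivial; split; trivial.
    eapply prefix_of_set_trans; eauto.
  - exists w; intros l Hl; destruct (HX l) as [t Ht]; exists t, (orbit k t).
    assert (St := proj1 (proj1 (restriction_iff _ _ _) Ht)).
    split; trivial; split; [now apply iterate_orbit|].
    apply prefix_trans with (orbit k s); auto using orbit_string.
    apply orbit_prefix; trivial; eapply restriction_prefix; eauto.
Qed.

(** * Existence of a recurrent point *)

Section RecurrentPoint.
Context (C : sets M) (HC : is_tree C)
        (C_closed : forall s t, s is_in C -> pair s t is_in f -> t is_in C).

Lemma orbit_in_tree k s : s is_in C -> orbit k s is_in C.
Proof.
  intro Hs; induct k by definable; [now rewrite orbit_0|].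
  apply C_closed with (1 := IH), image_graph; [now apply HC | apply orbit_succ].
Qed.

(** The orbit of a finite string may be too short to tell whether it has returned
    to [s], so compatibility is all that can be asked.  Requiring it only for
    [s] up to the length of [u] means that, for given length, the range of [s] is
    known before the string is chosen. *)
Definition seems_recurrent (u : num M) : Prop :=
  forall s, s < len u + 1 -> is_string s -> prefix s u ->
    exists k, k < s + pow3 s + 1 /\ s <= k /\
      (prefix s (orbit k u) \/ prefix (orbit k u) s).

Lemma delta_seems_recurrent : delta (fun e => seems_recurrent (e O)).
Proof. unfold seems_recurrent; definable. Qed.

(** Whatever is a prefix of [v] or of an iterate of [v] is compatible with the
    corresponding iterate of [u]: both lie below a common string. *)
Lemma seems_recurrent_prefix u v : is_string u -> is_string v -> prefix u v ->
  seems_recurrent v -> seems_recurrent u.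
Proof.
  intros Hu Hv P R s Hs Ss Ps.
  destruct (R s) as (k & Hk & Hsk & H); trivial.
  - apply prefix_elim in P as [P _]; linear (Hs, P).
  - now apply prefix_trans with u.
  - exists k; split; [trivial|split; trivial].
    assert (P' := orbit_prefix k u v Hu Hv P).
    assert (Ou := orbit_string k u Hu); assert (Ov := orbit_string k v Hv).
    destruct (le_or_lt (len s) (len (orbit k u))) as [L|L]; destruct H as [H|H].
    + left; now apply prefix_of_common with (orbit k v).
    + left; apply prefix_of_common with (orbit k v); trivial.
      apply prefix_flip; trivial.
      apply le_trans with (1 := L); now apply prefix_elim.
    + right; apply prefix_of_common with (orbit k v); trivial; now apply lt_le.
    + right; now apply prefix_trans with (orbit k v).
Qed.

(** A string [u] of length [l] is tested on [s <= l] only.  So take an index [i]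
    from [uniform_returns] for [l + 1] on the orbit of a restriction of [Z] that
    is long enough for [x_i] to have length [l], and truncate [x_i]. *)
Lemma seems_recurrent_exists l : (exists Z, is_path C Z) ->
  exists u, u is_in C /\ len u = l /\ seems_recurrent u.
Proof.
  intros [Z HZ]; destruct (orbit_length l (pow3 (l + 1))) as [w Hw].
  destruct (HZ w) as (z & Hz & Cz); apply restriction_iff in Hz as (Sz & Lz & _).
  destruct (uniform_returns (fun s i => prefix s (orbit i z))) with (s := l + 1) (a := 0 : num M)
    as (i & Hi & _ & Ri); [definable|].
  rewrite add_0_l in Hi.
  assert (Hzi := orbit_string i z Sz).
  destruct (truncation (orbit i z) l) as (u & Su & Lu & Pu); trivial.
  { apply Hw; trivial; [rewrite Lz; apply le_refl | apply lt_succ_le, lt_le, Hi]. }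
  exists u; split; [|split; trivial].
  - apply (proj2 HC u (orbit i z)); trivial; now apply orbit_in_tree.
  - intros s Hs Ss Ps; rewrite Lu in Hs.
    destruct (Ri s Hs) as (k & Hk & Hsk & Pk); [now apply prefix_trans with u|].
    exists k; split; [trivial|split; trivial].
    unfold orbit in Pk; rewrite (iter_add _ recursive_image) in Pk.
    fold (orbit i z) in Pk; fold (orbit k (orbit i z)) in Pk.
    assert (P := orbit_prefix k u _ Su Hzi Pu).
    assert (Ok := orbit_string k u Su).
    destruct (le_or_lt (len s) (len (orbit k u))) as [L|L]; [left|right].
    + now apply prefix_of_common with (orbit k (orbit i z)).
    + apply prefix_of_common with (orbit k (orbit i z)); trivial; now apply lt_le.
Qed.

(** Along a path, compatibility with [s] becomes extension of [s], as the
    restriction [u] can be chosen so long that its iterates are longer than [s]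
    at all candidate return times. *)
Lemma recurrent_of_restrictions X : is_path C X ->
  (forall l s, restriction X l s -> seems_recurrent s) -> recurrent_point C f X.
Proof.
  intros HX HR; split; trivial; intros n c.
  assert (HX' : forall n, exists s, restriction X n s)
    by (intro m; destruct (HX m) as (s & Hs & _); eauto).
  destruct (HX' c) as [r Hr], (HX' (c + n)) as [s Hs].
  destruct (orbit_length (c + n) (s + pow3 s)) as [w Hw].
  (* [w] makes the iterates of [u] long enough, [s] gets [s] tested on [u], and
     [c + n] makes [u] extend [s]. *)
  destruct (HX' (w + s + c + n)) as [u Hu].
  assert (Prs : prefix r s) by (eapply restriction_prefix; eauto using le_add).
  assert (Psu : prefix s u)
    by (eapply restriction_prefix; eauto; linear (le_zero w, le_zero s)).
  assert (Hu' := proj1 (restriction_iff _ _ _) Hu); destruct Hu' as (Su & Lu & _).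
  assert (Hs' := proj1 (restriction_iff _ _ _) Hs); destruct Hs' as (Ss & Ls & _).
  assert (Hr' := proj1 (restriction_iff _ _ _) Hr); destruct Hr' as (Sr & _ & _).
  destruct (HR _ u Hu s) as (k & Hk & Hsk & Hret); trivial.
  { rewrite Lu; linear (le_zero w, le_zero c, le_zero n). }
  assert (Ok := orbit_string k u Su).
  assert (Pk : prefix s (orbit k u)).
  { destruct Hret as [H|H]; trivial; apply prefix_flip; trivial.
    rewrite Ls; apply Hw; trivial; rewrite Lu; linear (le_zero s, le_zero c, le_zero n). }
  assert (Hnk : n <= k).
  { apply le_trans with s; trivial; apply le_trans with (len s); [|now apply len_le].
    rewrite Ls; linear (le_zero c). }
  apply le_exists in Hnk as [d ->].
  destruct (iterated_image_exists (n + d) X HX') as (Y & HY & HYp).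
  exists d, Y, r; split; trivial; split; trivial.
  apply (HYp _ u r Hu Sr); now apply prefix_trans with s.
Qed.

Lemma recurrent_point_exists : WKL M -> (exists Z, is_path C Z) ->
  exists X, recurrent_point C f X.
Proof.
  intros HW HZ; assert (D := delta_seems_recurrent).
  destruct (delta_comprehension (fun u => u is_in C /\ seems_recurrent u)) as [T HT];
    [definable|].
  destruct (HW T) as [X HX].
  - split.
    + intros u Hu; apply HC; now apply HT.
    + intros s t Hs Ht P; apply HT in Ht as [Ct Rt]; apply HT; split.
      * now apply (proj2 HC s t).
      * apply seems_recurrent_prefix with t; trivial; now apply HC.
  - intro l; destruct (seems_recurrent_exists l HZ) as (u & Cu & Lu & Ru).
    exists u; split; [now apply HT|].
    rewrite <- Lu; apply len_le; now apply HC.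
  - exists X; apply recurrent_of_restrictions.
    + intro n; destruct (HX n) as (s & Hs & H); exists s; split; trivial; now apply HT.
    + intros l s Hs; destruct (HX l) as (t & Ht & H); apply HT in H as [_ H].
      replace s with t; trivial.
      apply restriction_iff in Hs as (Ss & Ls & Bs), Ht as (St & Lt & Bt).
      apply string_ext; trivial; [congruence|].
      intros i Hi; rewrite (prefix_of_set_elim t X Bt i Hi); symmetry.
      apply (prefix_of_set_elim s X Bs); congruence.
Qed.

End RecurrentPoint.
End System.
End Model.

Theorem theorem7 : forall M : L2_structure, RCA0 M -> WKL M -> RP M.
Proof.
  intros M HM HW C f (HC & Hf & HZ & C_closed).
  exact (recurrent_point_exists HM f Hf C HC C_closed HW HZ).
Qed.
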